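(* Let $P\subset\mathbb{R}^n$ be a bounded open convex set containing the origin and let $k>0$. Suppose $u:\mathbb{R}^n\to\mathbb{R}$ is a convex function solving $$\det D^2u=(u^{\star})^{n+2}(-u)_+^{k}\ \text{ in }\mathbb{R}^n,\qquad \nabla u(\mathbb{R}^n)=\overline P .$$ Then the free boundary $\{u=0\}$ is strictly convex, in the sense that it does not contain a line segment.
   Context: Here $u^{\star}(x):=\langle x,\nabla u(x)\rangle-u(x)$ and $(-u)_+=\max(-u,0)$. The equation is understood in the Alexandrov sense. The function $u$ is the Legendre transform $u(x)=\sup_{y\in P}(\langle x,y\rangle-v(y))$ of a positive convex function $v$ on $\overline P$ with $\inf v>0$; in particular $u(0)<0$. A line segment means a nondegenerate one. *)

(* Defs.v *)
From HB Require Import structures.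
From mathcomp Require Import all_boot all_order all_algebra.
From mathcomp Require Import all_classical all_reals all_analysis.

Set Implicit Arguments.
Unset Strict Implicit.
Unset Printing Implicit Defensive.

Import Order.TTheory GRing.Theory Num.Theory.
Import numFieldNormedType.Exports.

Local Open Scope classical_set_scope.
Local Open Scope ring_scope.

Section LebesgueMeasure.
Context (R : realType) (n : nat).

Definition box (c : 'rV[R]_n * 'rV[R]_n) : set 'rV[R]_n :=
  [set x | forall i, c.1 0 i <= x 0 i <= c.2 0 i].

Definition box_volume (c : 'rV[R]_n * 'rV[R]_n) : R :=
  \prod_(i < n) Num.max (c.2 0 i - c.1 0 i) 0.

(* The library has Lebesgue measure on R only.  On R^n we take the Lebesgue
   outer measure and the library's Caratheodory construction.  Covers are
   indexed by an arbitrary set of naturals, so that they may be finite or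
   empty; this makes the measure of set0 vanish also when n = 0. *)
Definition lebesgue_outer (A : set 'rV[R]_n) : \bar R :=
  ereal_inf [set (\esum_(k in C.1) (box_volume (C.2 k))%:E)%E |
    C in [set C : set nat * (nat -> 'rV[R]_n * 'rV[R]_n) |
          A `<=` \bigcup_(k in C.1) box (C.2 k)]].

Let box_volume_ge0 c : (0 <= (box_volume c)%:E)%E.
Proof.
by rewrite lee_fin; apply: prodr_ge0 => i _; rewrite le_max lexx orbT.
Qed.

Lemma lebesgue_outer_ge0 A : (0 <= lebesgue_outer A)%E.
Proof.
by apply: le_ereal_inf_tmp => _ [C _ <-]; apply: esum_ge0 => k _.
Qed.

Lemma lebesgue_outer0 : lebesgue_outer set0 = 0%E.
Proof.
apply/eqP; rewrite eq_le lebesgue_outer_ge0 andbT.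
apply: ereal_inf_lbound; exists (set0, fun=> (0, 0)); first by move=> x [].
by rewrite esum_set0.
Qed.

Lemma le_lebesgue_outer :
  {homo lebesgue_outer : A B / A `<=` B >-> (A <= B)%E}.
Proof.
move=> A B AB; apply: ereal_inf_le_tmp => _ [C BC <-]; exists C => //.
exact: subset_trans AB BC.
Qed.

Lemma lebesgue_outer_sigma_subadditive : sigma_subadditive lebesgue_outer.
Proof.
move=> A; have [[i ioo]|] := pselect (exists i, lebesgue_outer (A i) = +oo%E).
  rewrite (eseries_pinfty _ _ ioo) ?leey// => j _.
  by rewrite -ltNye (lt_le_trans _ (lebesgue_outer_ge0 _)).
rewrite -forallNE => Aoo.
apply/lee_addgt0Pr => _/posnumP[e].
rewrite (le_trans _ (epsilon_trick _ _ _))//; last first.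
  by move=> k; exact: lebesgue_outer_ge0.
pose P j (C : set nat * (nat -> 'rV[R]_n * 'rV[R]_n)) :=
  A j `<=` \bigcup_(k in C.1) box (C.2 k) /\
  (\esum_(k in C.1) (box_volume (C.2 k))%:E <=
   lebesgue_outer (A j) + (e%:num / (2 ^ j.+1)%:R)%:E)%E.
have [G PG] : {G : nat -> set nat * (nat -> 'rV[R]_n * 'rV[R]_n) &
    forall j, P j (G j)}.
  apply: (@choice _ _ P) => j.
  have fin : lebesgue_outer (A j) \is a fin_num.
    by rewrite ge0_fin_numE ?lebesgue_outer_ge0// ltey; apply/eqP/Aoo.
  have e0 : 0 < e%:num / (2 ^ j.+1)%:R :> R by [].
  have [x [C AC <-] xlt] := lb_ereal_inf_adherent e0 fin.
  by exists C; split => //; exact: ltW.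
have /card_esym/ppcard_eqP[f] := card_nat2.
pose D := [set m | (G (f m).1).1 (f m).2].
pose c m := (G (f m).1).2 (f m).2.
apply: (@le_trans _ _ (\esum_(m in D) (box_volume (c m))%:E)%E).
  apply: ereal_inf_lbound; exists (D, c) => //= x [j _ Ajx].
  have [k Gk xk] := (PG j).1 _ Ajx.
  by exists (f^-1%FUN (j, k)); rewrite /D /c /= invK ?inE.
have fD : set_bij D (setT `*`` (fun j => (G j).1)) f.
  split=> [m Dm|m1 m2 _ _ /(congr1 f^-1%FUN)|[j k] [_ Gk]].
  - by split.
  - by rewrite !funK ?inE.
  - by exists (f^-1%FUN (j, k)); rewrite /D /= invK ?inE.
rewrite -(reindex_esum _ _ _ (fun p => (box_volume ((G p.1).2 p.2))%:E) fD).
rewrite -(@esum_esum _ _ _ setT (fun j => (G j).1)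
  (fun j k => (box_volume ((G j).2 k))%:E)); last by [].
rewrite -nneseries_esumT; last by move=> *; exact: esum_ge0.
apply: lee_nneseries => [j _ _|j _]; first exact: esum_ge0.
exact: (PG j).2.
Qed.

HB.instance Definition _ := isOuterMeasure.Build R 'rV[R]_n lebesgue_outer
  lebesgue_outer0 lebesgue_outer_ge0 le_lebesgue_outer
  lebesgue_outer_sigma_subadditive.

Let outer : {outer_measure set 'rV[R]_n -> \bar R} := lebesgue_outer.

Definition lebesgue_rV : {measure set (caratheodory_type outer) -> \bar R} :=
  (outer : set (caratheodory_type outer) -> \bar R).

End LebesgueMeasure.

Section MongeAmpere.
Context (R : realType) (n : nat).
Implicit Types (u v : 'rV[R]_n -> R) (P : set 'rV[R]_n).

Definition dotp (x y : 'rV[R]_n) : R := \sum_(i < n) x 0 i * y 0 i.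

(* Meaningful where u is differentiable, hence almost everywhere when u is
   convex. *)
Definition gradient u (x : 'rV[R]_n) : 'rV[R]_n :=
  \row_(i < n) 'D_(delta_mx 0 i) u x.

Definition star u (x : 'rV[R]_n) : R := dotp x (gradient u x) - u x.

Definition legendre P v (x : 'rV[R]_n) : R :=
  sup [set dotp x y - v y | y in P].

Definition subdifferential u (x : 'rV[R]_n) : set 'rV[R]_n :=
  [set p | forall y, u x + dotp p (y - x) <= u y].

(* The image of E under grad u for a convex u that need not be C^1. *)
Definition subgradient_image u (E : set 'rV[R]_n) : set 'rV[R]_n :=
  \bigcup_(x in E) subdifferential u x.

Definition borel_rV : set (set 'rV[R]_n) :=
  <<s [set A : set 'rV[R]_n | open A] >>.

(* det D^2 u = g on R^n in the Alexandrov sense *)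
Definition alexandrov_solution u (g : 'rV[R]_n -> R) :=
  forall E : set 'rV[R]_n, borel_rV E ->
    lebesgue_rV R n (subgradient_image u E) =
    (\int[lebesgue_rV R n]_(x in E) (g x)%:E)%E.

Definition segment (a b : 'rV[R]_n) : set 'rV[R]_n :=
  [set (1 - t) *: a + t *: b | t in `[0, 1]].

Definition contains_no_segment (A : set 'rV[R]_n) :=
  forall a b : 'rV[R]_n, a != b -> ~ (segment a b `<=` A).

End MongeAmpere.

(* Main.v *)
(* Suppose u vanishes on a segment [a, b], and let l be an affine function
   supporting u at its midpoint, so that W = u - l >= 0 vanishes on [a, b].
   Since P is open and the slope of l is one fixed vector p0, some q in P makes
   d = q - p0 nonconstant on [a, b].  As q is interior to P, the sections
   S = {u <= l + e (d - t)} are bounded and shrink, as e -> 0, to the part of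
   the contact set C = {W = 0} where d >= t.

   Let xh maximize d over C /\ {u <= 0}.  If d were larger somewhere else on C,
   a section cutting off only that place would carry no Monge-Ampere mass,
   although its gradient image contains a ball.  So xh maximizes d over C.  Let
   a be a point of C /\ {u <= 0} with d a < d xh = M, t = d a, and z the
   midpoint of a and xh.  Write S^x for the polar of S about x.

   (1) Comparison with a cone of vertex xh: the gradient image of S contains,
       up to translation, e (M - t) S^xh.
   (2) The gradient image of (z + S) / 2 lies, up to translation, in
       4 e (M - t) S^z.
   (3) The Monge-Ampere mass of S is at most a constant times that of
       (z + S) / 2: its density is comparable to (-u)_+ ^ k, and
       (-u)_+ ((x + z) / 2) >= (-u)_+ (x) / 2 because u z <= 0 and u is convex.
   (4) d <= M + o(1) on S, so S^xh contains a multiple of d tending to infinity;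
       hence the volume of S^xh divided by that of S^z tends to infinity.

   No John ellipsoid is needed, as (1)-(4) only compare polars of the same set.
   The density is bounded below only where u is differentiable, which is almost
   everywhere. *)

Require Import Defs.
From mathcomp Require Import all_boot all_order all_algebra.
From mathcomp Require Import all_classical all_reals all_analysis.
From mathcomp Require Import measurable_realfun ring lra.

Import Order.TTheory GRing.Theory Num.Theory.
Import numFieldNormedType.Exports.

Local Open Scope classical_set_scope.
Local Open Scope ring_scope.

(** * Lebesgue measure on R^n *)

Section Lebesgue.
Context {R : realType} {n : nat}.
Local Notation V := 'rV[R]_n.
Implicit Types (A B : set V) (c x y z : V) (t : R).

Definition homothety c t x : V := c + t *: x.

Lemma homothetyK c t : t != 0 ->
  cancel (homothety c t) (homothety (- (t^-1 *: c)) t^-1).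
Proof.
by move=> t0 x; rewrite /homothety scalerDr scalerA mulVf// scale1r addKr.
Qed.

Lemma box_volume_ge0 (b : V * V) : 0 <= box_volume b.
Proof. by apply: prodr_ge0 => i _; rewrite le_max lexx orbT. Qed.

Lemma box_volume_homothety c t (b : V * V) : 0 <= t ->
  box_volume (homothety c t b.1, homothety c t b.2) = t ^+ n * box_volume b.
Proof.
move=> t0; rewrite /box_volume.
have -> : t ^+ n = \prod_(i < n) t by rewrite prodr_const card_ord.
rewrite -big_split/=; apply: eq_bigr => i _; rewrite !mxE maxr_pMr// mulr0;
  congr (Num.max _ _).
by rewrite opprD addrACA subrr add0r mulrBr.
Qed.

Lemma esumZl_le (D : set nat) (a : nat -> \bar R) t : 0 <= t ->
  (forall k, 0 <= a k)%E ->
  (\esum_(k in D) (t%:E * a k) <= t%:E * \esum_(k in D) a k)%E.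
Proof.
move=> t0 a0; apply: ge_ereal_sup => _ [F [finF FD] <-].
rewrite -ge0_mule_fsumr//; apply: lee_wpmul2l; first by rewrite lee_fin.
by apply: ereal_sup_ubound; exists F.
Qed.

Lemma lebesgue_outer_homothety_le c t A : 0 < t ->
  (lebesgue_outer (homothety c t @` A) <= (t ^+ n)%:E * lebesgue_outer A)%E.
Proof.
move=> t0; rewrite -lee_pdivrMl ?exprn_gt0//.
apply: le_ereal_inf_tmp => _ [C AC <-]; rewrite lee_pdivrMl ?exprn_gt0//.
apply: le_trans (esumZl_le C.1 _ _ (exprn_ge0 n (ltW t0)) _); last first.
  by move=> k; rewrite lee_fin box_volume_ge0.
apply: ereal_inf_lbound.
exists (C.1, fun k => (homothety c t (C.2 k).1, homothety c t (C.2 k).2)) => /=.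
  move=> _ [x /AC [k Ck xk] <-]; exists k => // i.
  by rewrite !mxE !lerD2l !ler_pM2l.
apply: eq_esum => k _; rewrite -EFinM; congr EFin.
exact: box_volume_homothety (ltW t0).
Qed.

(** The reverse inequality is the same bound applied to the inverse homothety. *)
Lemma lebesgue_outer_homothety c t A : 0 < t ->
  lebesgue_outer (homothety c t @` A) = ((t ^+ n)%:E * lebesgue_outer A)%E.
Proof.
move=> t0; apply/eqP; rewrite eq_le lebesgue_outer_homothety_le//=.
have := lebesgue_outer_homothety_le (- (t^-1 *: c)) (t^-1) (homothety c t @` A).
rewrite image_comp (_ : [set _ | _ in A] = A); last first.
  by apply: eq_image_id => x /=; rewrite homothetyK// gt_eqF.
rewrite invr_gt0 => /(_ t0).
by rewrite exprVn lee_pdivlMl ?exprn_gt0.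
Qed.

Lemma lebesgue_outer_translate c A :
  lebesgue_outer [set c + x | x in A] = lebesgue_outer A.
Proof.
have := lebesgue_outer_homothety c 1 A ltr01.
rewrite expr1n mul1e => <-; congr lebesgue_outer.
by apply: eq_imagel => x _; rewrite /homothety scale1r.
Qed.

Lemma lebesgue_outer_box (b : V * V) :
  (lebesgue_outer (box b) <= (box_volume b)%:E)%E.
Proof.
apply: ereal_inf_lbound; exists ([set 0%N], fun=> b).
  by move=> x bx; exists 0%N.
by rewrite esum_set1// lee_fin box_volume_ge0.
Qed.

(** The hyperplane [x 0 i = t] cuts every box of a cover into two boxes whose volumes add up. One of
    them may have a negative side, and then its volume is 0 by the truncation in [box_volume]. *)
Lemma caratheodory_le (i : 'I_n) t :
  caratheodory_measurable (@lebesgue_outer R n) [set x | x 0 i <= t].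
Proof.
apply: le_caratheodory_measurable => X.
apply: le_ereal_inf_tmp => _ [C XC <-].
pose lo (b : V * V) : V * V :=
  (b.1, \row_j if j == i then Num.min (b.2 0 i) t else b.2 0 j).
pose hi (b : V * V) : V * V :=
  (\row_j if j == i then Num.max (b.1 0 i) t else b.1 0 j, b.2).
have vol b : box_volume b = box_volume (lo b) + box_volume (hi b).
  rewrite /box_volume [LHS](bigD1 i)//= [X in _ = X + _](bigD1 i)//=.
  rewrite [X in _ = _ + X](bigD1 i)//= !mxE eqxx.
  rewrite [in X in _ = X + _](eq_bigr (fun j => Num.max (b.2 0 j - b.1 0 j) 0)).
    rewrite [in X in _ = _ + X](eq_bigr (fun j =>
      Num.max (b.2 0 j - b.1 0 j) 0)).
      rewrite -mulrDl; congr (_ * _).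
      rewrite /Num.max/Num.min; repeat case: ifPn; rewrite -?leNgt; lra.
    by move=> j ji; rewrite !mxE (negbTE ji).
  by move=> j ji; rewrite !mxE (negbTE ji).
rewrite (@eq_esum _ _ _ _ (fun k => (box_volume (lo (C.2 k)))%:E +
  (box_volume (hi (C.2 k)))%:E)%E); last by move=> k _; rewrite vol EFinD.
rewrite esumD; [|by move=> *; rewrite lee_fin box_volume_ge0..].
apply: leeD; apply: ereal_inf_lbound.
  exists (C.1, lo \o C.2) => //= x [/XC [k Ck bx] xt]; exists k => // j.
  have := bx j; rewrite !mxE /=; case: eqP => [->|//] /andP[-> /=].
  by rewrite le_min => ->.
exists (C.1, hi \o C.2) => //= x [/XC [k Ck bx] xt]; exists k => // j.
have := bx j; rewrite !mxE /=; case: eqP => [->|//] /andP[h1 ->].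
by rewrite ge_max h1/= andbT; move/negP: xt; rewrite -ltNge => /ltW.
Qed.

Lemma lebesgue_measurable_le (i : 'I_n) t :
  measurable
    ([set x | x 0 i <= t] : set (caratheodory_type (@lebesgue_outer R n))).
Proof. exact: caratheodory_le. Qed.

Lemma lebesgue_measurable_ge (i : 'I_n) t :
  measurable
    ([set x | t <= x 0 i] : set (caratheodory_type (@lebesgue_outer R n))).
Proof.
rewrite (_ : mkset _ = \bigcap_k ~` [set x | x 0 i <= t - k.+1%:R^-1]).
  by apply: bigcapT_measurable => k; apply: measurableC;
    exact: lebesgue_measurable_le.
apply/seteqP; split => x /= => [tx k _ /=|h].
  apply/negP; rewrite -ltNge; apply: lt_le_trans tx.
  by rewrite ltrBlDr ltrDl invr_gt0.
apply/ler_addgt0Pr => e e0.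
have [k _ /(_ k (leqnn _)) /= ke] := near_infty_natSinv_lt (PosNum e0).
have /(_ Logic.I) /negP := h k; rewrite -ltNge => h'.
rewrite -lerBlDr (le_trans _ (ltW h'))// lerD2l lerN2 ltW//.
Qed.

Lemma lebesgue_measurable_box (b : V * V) :
  measurable (box b : set (caratheodory_type (@lebesgue_outer R n))).
Proof.
rewrite (_ : box b = \bigcap_(i in [set: 'I_n])
  ([set x | b.1 0 i <= x 0 i] `&` [set x | x 0 i <= b.2 0 i])); last first.
  apply/seteqP; split => x /= => [h i _|h i].
    by have /andP[] := h i; split.
  by have [/= -> ->] := h i Logic.I.
apply: fin_bigcap_measurable => // i _; apply: measurableI.
  exact: lebesgue_measurable_ge.
exact: lebesgue_measurable_le.
Qed.

Lemma norm_coord (x : V) i : `|x 0 i| <= `|x|.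
Proof.
have -> : `|x| = mx_norm x by [].
rewrite mx_normrE; exact: (le_bigmax _ (fun ij => `|x ij.1 ij.2|) (ord0, i)).
Qed.

Lemma norm_coord_le (x : V) r :
  0 <= r -> (forall i, `|x 0 i| <= r) -> `|x| <= r.
Proof.
move=> r0 xr; have -> : `|x| = mx_norm x by [].
rewrite mx_normrE; apply: bigmax_le => // -[i j] _ /=.
by rewrite ord1.
Qed.

Lemma open_ball A x : open A -> A x ->
  exists2 e, 0 < e & forall y, `|y - x| < e -> A y.
Proof.
move=> oA Ax; have /nbhs_ballP[e e0 xA] := open_nbhs_nbhs (conj oA Ax).
exists e => // y yx; apply: xA; rewrite mx_norm_ball /ball_/=.
by rewrite distrC.
Qed.

(** Closed lattice cells of mesh [1 / p.1.+1]. The index type is countable, so an open set becomes a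
    countable union of boxes; in the sup norm a cell has diameter at most its mesh. *)
Definition grid_box (p : nat * 'rV[int]_n) : set V :=
  box (\row_i ((p.2 0 i)%:~R / p.1.+1%:R),
       \row_i ((p.2 0 i + 1)%:~R / p.1.+1%:R)).

Lemma open_grid A : open A ->
  A = \bigcup_p (if pselect (grid_box p `<=` A) then grid_box p else set0).
Proof.
move=> oA; apply/seteqP; split => x; last first.
  by case=> p _; case: pselect => // pA /pA.
move=> /(open_ball _ _ oA) [e e0 eA].
have [k _ /(_ k (leqnn _)) /= ke] := near_infty_natSinv_lt (PosNum e0).
have k0 : 0 < k.+1%:R :> R by [].
exists (k, \row_i Num.floor (x 0 i * k.+1%:R)) => //; case: pselect => [_ i|].
  rewrite !mxE ler_pdivrMr// ler_pdivlMr//.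
  by have /andP[-> /ltW ->] := floor_itv (x 0 i * k.+1%:R).
case=> y /= yb; apply: eA; apply: le_lt_trans ke.
apply: norm_coord_le => [|i]; first by rewrite invr_ge0.
have := yb i; rewrite !mxE ler_pdivrMr// ler_pdivlMr//.
have /andP[] := floor_itv (x 0 i * k.+1%:R).
rewrite intrD -[k.+1%:R^-1]mul1r ler_pdivlMr// -[X in _ -> _ -> _ ->
  _ * X <= _](gtr0_norm k0) -normrM.
by rewrite mulrBl ler_norml /=; lra.
Qed.

Lemma lebesgue_measurable_open A : open A ->
  measurable (A : set (caratheodory_type (@lebesgue_outer R n))).
Proof.
move=> /open_grid ->; apply: countable_bigcupT_measurable => [|p].
  exact: countableP.
by case: pselect => pA; [exact: lebesgue_measurable_box|exact: measurable0].
Qed.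

Lemma lebesgue_measurable_borel A : borel_rV A ->
  measurable (A : set (caratheodory_type (@lebesgue_outer R n))).
Proof.
move=> /(_ (measurable : set (set (caratheodory_type (@lebesgue_outer R n))))).
apply; split; last exact: lebesgue_measurable_open.
split; [exact: measurable0| |by move=> F mF; exact: bigcupT_measurable].
by move=> B; rewrite setTD; exact: measurableC.
Qed.

Lemma borel_open A : open A -> borel_rV A.
Proof. exact: sub_gen_smallest. Qed.

Lemma borel_closed A : closed A -> borel_rV A.
Proof.
move=> cA; rewrite -(setCK A) -setTD; apply: sigma_algebraCD.
by apply: borel_open; exact: closed_openC.
Qed.

End Lebesgue.

(** * Positive measure of the unit cube *)

Section CubePositive.
Context {R : realType}.

(* Integrate the covering inequality one coordinate at a time. *)
Lemma cube_cover (n : nat) (lo hi : nat -> nat -> R) (c : nat -> R) :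
  (forall k, 0 <= c k) ->
  (forall x : nat -> R, (forall i, x i \in `[0, 1]) ->
    (1 <= \sum_(0 <= k <oo)
      (c k * \prod_(i < n) \1_`[lo k i, hi k i] (x i))%:E)%E) ->
  (1 <= \sum_(0 <= k <oo)
    (c k * \prod_(i < n) Num.max (hi k i - lo k i) 0)%:E)%E.
Proof.
elim: n c => [|n IH] c c0 h.
  have := h (fun=> 0); rewrite in_itv/= lexx ler01 => /(_ (fun=> erefl)).
  move/le_trans; apply; apply: lee_nneseries => [k _ _|k _];
    rewrite ?lee_fin ?big_ord0 ?mulr1//.
(* Integrating out the last coordinate replaces its indicator by at most the length of its interval.
   The weight absorbs this factor, which is why the statement carries weights. *)
pose d k := c k * Num.max (hi k n - lo k n) 0.
rewrite (eq_eseriesr (g := fun k =>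
    (d k * \prod_(i < n) Num.max (hi k i - lo k i) 0)%:E)); last first.
  by move=> k _; rewrite big_ord_recr/= mulrCA mulrC /d.
apply: IH => [k|x x01]; first by rewrite mulr_ge0// le_max lexx orbT.
pose p k := c k * \prod_(i < n) \1_`[lo k i, hi k i] (x i).
have p0 k : 0 <= p k by rewrite mulr_ge0// prodr_ge0.
pose q k (s : R) : R := p k * \1_`[lo k n, hi k n] s.
have m1 k : measurable_fun (`[0, 1]%classic : set R) (fun s : R => (q k s)%:E).
  by apply/measurable_EFinP; apply: measurable_funM.
have q0 k s : (0 <= (q k s)%:E)%E by rewrite lee_fin mulr_ge0.
have : (\int[lebesgue_measure]_(s in `[0%R, 1%R]) 1 <=
  \int[lebesgue_measure]_(s in `[0%R, 1%R]) (\sum_(0 <= k <oo) (q k s)%:E))%E.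
  apply: ge0_le_integral => //.
  - by apply: ge0_emeasurable_sum => k *; [exact: q0|exact: m1].
  - move=> s s01; have := h (fun i => if i == n then s else x i).
    have h1 i : (if i == n then s else x i) \in `[0, 1] by case: ifP.
    move=> /(_ h1)/le_trans; apply; apply: lee_nneseries => k _.
      by move=> _; rewrite lee_fin mulr_ge0// prodr_ge0.
    rewrite big_ord_recr/= eqxx mulrA lee_fin le_eqVlt; apply/orP; left.
    apply/eqP; congr (_ * _ * _); apply: eq_bigr => i _.
    by rewrite ltn_eqF.
have -> : (\int[lebesgue_measure]_(s in `[0%R, 1%R]) 1 = 1 :> \bar R)%E.
  have -> := @integral_cst _ _ R lebesgue_measure `[0%R, 1%R]%classic _ 1%E.
    by rewrite mul1e; have := lebesgue_measure_itv `[0 : R, 1];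
      rewrite /= lte_fin ltr01 sube0.
  exact: measurable_itv.
move/le_trans; apply; rewrite integral_nneseries//.
apply: lee_nneseries => [k _ _|k _]; first by apply: integral_ge0.
rewrite /q; under eq_integral do rewrite EFinM.
rewrite ge0_integralZl ?lee_fin//; last first.
  by apply/measurable_EFinP; exact: measurable_indic.
have -> : d k * \prod_(i < n) \1_`[lo k i, hi k i] (x i) =
    p k * Num.max (hi k n - lo k n) 0 by rewrite mulrAC.
rewrite (EFinM (p k)); apply: lee_wpmul2l; first by rewrite lee_fin.
rewrite integral_indic//.
apply: (@le_trans _ _ (lebesgue_measure `[lo k n, hi k n]%classic)).
  by apply: le_measure; rewrite ?inE//; exact: measurableI.
rewrite lebesgue_measure_itv/= lte_fin; case: ifPn => _.
  by rewrite lee_fin le_max lexx.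
by rewrite lee_fin le_max lexx orbT.
Qed.

(** Weights 1 on the index set of the cover and 0 off it make the covering property a pointwise
    lower bound on a sum of indicators. *)
Lemma lebesgue_outer_cube (n : nat) :
  (1 <= @lebesgue_outer R n (box (0%R, const_mx 1%R)))%E.
Proof.
apply: le_ereal_inf_tmp => _ [C AC <-].
rewrite esum_mkcond -nneseries_esumT; last first.
  by move=> k; case: ifPn => // _; rewrite lee_fin box_volume_ge0.
(* The default 0 serves indices outside ['I_n], which the products never read. *)
pose lo k i := if insub i is Some j then (C.2 k).1 0 (j : 'I_n) else 0.
pose hi k i := if insub i is Some j then (C.2 k).2 0 (j : 'I_n) else 0.
pose c k : R := if k \in C.1 then 1 else 0.
have c0 k : 0 <= c k by rewrite /c; case: ifP.
have := @cube_cover n lo hi c c0.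
rewrite (eq_eseriesr (g := fun k =>
    if k \in C.1 then (box_volume (C.2 k))%:E else 0%E)).
  apply=> x x01; have : box (0, const_mx 1) (\row_i x i : 'rV[R]_n).
    by move=> i; rewrite !mxE; have := x01 i; rewrite in_itv.
  move=> /AC[k Ck kx].
  have ge0 m : (0 <= (c m * \prod_(i < n) \1_`[lo m i, hi m i] (x i))%:E)%E.
    by rewrite lee_fin mulr_ge0// prodr_ge0.
  apply: (@le_trans _ _ (\sum_(0 <= m < k.+1)
      (c m * \prod_(i < n) \1_`[lo m i, hi m i] (x i))%:E)%E); last first.
    by apply: nneseries_lim_ge => *.
  rewrite big_nat_recr//= (_ : (c k * _)%:E = 1%E); last first.
    rewrite /c mem_set// mul1r big1// => i _.
    rewrite indicE mem_set//= in_itv /lo /hi /= valK.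
    by have := kx i; rewrite !mxE.
  by rewrite leeDr// sume_ge0.
move=> k _; rewrite /c; case: ifP => _; last by rewrite mul0r.
by rewrite mul1r; congr EFin; apply: eq_bigr => i _; rewrite /hi /lo valK.
Qed.

End CubePositive.

Section LebesgueBounds.
Context {R : realType} {n : nat}.
Local Notation V := 'rV[R]_n.

Lemma lebesgue_outer_bounded_fin (A : set V) r :
  (forall x, A x -> `|x| <= r) -> (lebesgue_outer A < +oo)%E.
Proof.
move=> Ar; pose b : V * V := (const_mx (- r), const_mx r).
apply: (@le_lt_trans _ _ (lebesgue_outer (box b))).
  apply: le_lebesgue_outer => x /Ar xr i; rewrite !mxE -ler_norml.
  exact: le_trans (norm_coord _ _) xr.
by apply: le_lt_trans (lebesgue_outer_box _) _; rewrite ltry.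
Qed.

Lemma lebesgue_outer_ball_gt0 (A : set V) x r : 0 < r ->
  (forall y, `|y - x| <= r -> A y) -> (0 < lebesgue_outer A)%E.
Proof.
move=> r0 xA; apply: (@lt_le_trans _ _ (lebesgue_outer
   (homothety x r @` box (0, const_mx 1)))).
  rewrite lebesgue_outer_homothety// mule_gt0 ?lte_fin ?exprn_gt0//.
  by apply: lt_le_trans (lebesgue_outer_cube n); rewrite lte_fin.
apply: le_lebesgue_outer => _ [y yb <-]; apply: xA.
rewrite /homothety addrAC subrr add0r; apply: norm_coord_le => [|i].
  exact: ltW.
have := yb i; rewrite !mxE => /andP[y0 y1].
by rewrite ger0_norm ?mulr_ge0 ?ler_piMr// ltW.
Qed.

End LebesgueBounds.

(** * Polars and subgradients *)

Section Dotp.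
Context {R : realType} {n : nat}.
Local Notation V := 'rV[R]_n.
Implicit Types (x y z p q : V) (t : R).

Lemma dotpC x y : dotp x y = dotp y x.
Proof. by apply: eq_bigr => i _; rewrite mulrC. Qed.

Lemma dotpDl x y z : dotp (x + y) z = dotp x z + dotp y z.
Proof. by rewrite -big_split; apply: eq_bigr => i _; rewrite mxE mulrDl. Qed.

Lemma dotpZl t x y : dotp (t *: x) y = t * dotp x y.
Proof. by rewrite mulr_sumr; apply: eq_bigr => i _; rewrite mxE mulrA. Qed.

Lemma dotpNl x y : dotp (- x) y = - dotp x y.
Proof. by rewrite -scaleN1r dotpZl mulN1r. Qed.

Lemma dotpBl x y z : dotp (x - y) z = dotp x z - dotp y z.
Proof. by rewrite dotpDl dotpNl. Qed.

Lemma dotpDr z x y : dotp z (x + y) = dotp z x + dotp z y.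
Proof. by rewrite dotpC dotpDl !(dotpC z). Qed.

Lemma dotpZr z t x : dotp z (t *: x) = t * dotp z x.
Proof. by rewrite dotpC dotpZl dotpC. Qed.

Lemma dotpNr z x : dotp z (- x) = - dotp z x.
Proof. by rewrite dotpC dotpNl dotpC. Qed.

Lemma dotpBr z x y : dotp z (x - y) = dotp z x - dotp z y.
Proof. by rewrite dotpDr dotpNr. Qed.

Lemma dotp0l x : dotp 0 x = 0.
Proof. by rewrite -(scale0r 0) dotpZl mul0r. Qed.

Definition dotpE := (dotpDl, dotpDr, dotpNl, dotpNr, dotpZl, dotpZr).

Lemma dotp_delta i x t : dotp (t *: delta_mx 0 i) x = t * x 0 i.
Proof.
rewrite dotpZl /dotp (bigD1 i)//= mxE !eqxx mul1r big1 ?addr0// => j ji.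
by rewrite mxE (negbTE ji) andbF mul0r.
Qed.

Lemma dotp_self_gt0 x : x != 0 -> 0 < dotp x x.
Proof.
move=> x0; rewrite lt_neqAle eq_sym sumr_ge0 ?andbT//; last first.
  by move=> i _; rewrite -expr2 sqr_ge0.
apply: contra x0; rewrite psumr_eq0; last first.
  by move=> i _; rewrite -expr2 sqr_ge0.
move=> /allP h; apply/eqP/rowP => i; rewrite mxE.
by have := h i (mem_index_enum _); rewrite /= mulf_eq0 orbb => /eqP.
Qed.

Lemma dotp_norm x y : `|dotp x y| <= n%:R * (`|x| * `|y|).
Proof.
apply: le_trans (ler_norm_sum _ _ _) _.
rewrite -[n in n%:R]card_ord mulr_natl -sumr_const; apply: ler_sum => i _.
by rewrite normrM ler_pM// norm_coord.
Qed.

Definition is_lipschitz (f : V -> R) :=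
  exists2 L, 0 <= L & forall x y, `|f x - f y| <= L * `|x - y|.

Lemma lipschitz_continuous f : is_lipschitz f -> continuous f.
Proof.
move=> [L L0 fL] x A /nbhs_ballP[e e0 eA]; apply/nbhs_ballP.
exists (e / (L + 1)); first by rewrite /= divr_gt0// ltr_wpDl.
move=> y; rewrite mx_norm_ball /ball_/= => xy; apply: eA; rewrite /ball/=.
apply: le_lt_trans (fL x y) _; rewrite ltr_pdivlMr ?ltr_wpDl// in xy.
by apply: le_lt_trans xy; rewrite mulrC ler_wpM2l// lerDl.
Qed.

Lemma is_lipschitz_dotp p : is_lipschitz (fun x => dotp p x).
Proof.
exists (n%:R * `|p|) => [|x y]; first by rewrite mulr_ge0.
by rewrite -dotpBr -mulrA dotp_norm.
Qed.

Lemma is_lipschitz_cst t : is_lipschitz (fun=> t).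
Proof. by exists 0 => // x y; rewrite subrr normr0 mul0r. Qed.

Lemma is_lipschitzD f g : is_lipschitz f -> is_lipschitz g ->
  is_lipschitz (fun x => f x + g x).
Proof.
move=> [L L0 fL] [M M0 gM]; exists (L + M) => [|x y]; first exact: addr_ge0.
rewrite opprD addrACA mulrDl; apply: le_trans (ler_normD _ _) _.
exact: lerD.
Qed.

Lemma is_lipschitzN f : is_lipschitz f -> is_lipschitz (fun x => - f x).
Proof.
by move=> [L L0 fL]; exists L => // x y; rewrite -opprD normrN.
Qed.

Lemma is_lipschitzB f g : is_lipschitz f -> is_lipschitz g ->
  is_lipschitz (fun x => f x - g x).
Proof. by move=> ? /is_lipschitzN; exact: is_lipschitzD. Qed.

Lemma is_lipschitz_shift f a :
  is_lipschitz f -> is_lipschitz (fun x => f (x + a)).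
Proof.
move=> [L L0 fL]; exists L => // x y; apply: le_trans (fL _ _) _.
by rewrite opprD addrACA subrr addr0.
Qed.

Lemma closed_le_lipschitz f t : is_lipschitz f -> closed [set x | f x <= t].
Proof.
move=> /lipschitz_continuous cf.
by apply: (@closed_comp _ _ f [set s | s <= t]) => [y _|];
  [exact: cf|exact: closed_le].
Qed.

Lemma open_lt_lipschitz f t : is_lipschitz f -> open [set x | f x < t].
Proof.
move=> /lipschitz_continuous cf.
by apply: (@open_comp _ _ f [set s | s < t]) => [y _|];
  [exact: cf|exact: open_lt].
Qed.

Lemma lipschitz_min (K : set V) f : is_lipschitz f -> compact K -> K !=set0 ->
  exists2 x, K x & forall y, K y -> f x <= f y.
Proof.
move=> /lipschitz_continuous cf cK K0.
have [x /set_mem Kx fx] : exists2 x, x \in K & forall y, y \in K -> f x <= f y.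
  by apply: compact_EVT_min => //; exact: continuous_subspaceT.
by exists x => // y /mem_set/fx.
Qed.

End Dotp.

Section Polar.
Context {R : realType} {n : nat}.
Local Notation V := 'rV[R]_n.
Implicit Types (x y z p q : V) (S : set V).

Definition polar S z : set V := [set p | forall s, S s -> dotp p (s - z) <= 1].

(** Testing [p] at the points of [S] at distance [r] from [z] along each axis, on both sides, bounds
    every coordinate of [p] by [r^-1]. *)
Lemma polar_fin S z r : 0 < r -> (forall x, `|x - z| <= r -> S x) ->
  (lebesgue_outer (polar S z) < +oo)%E.
Proof.
move=> r0 zS; apply: (@lebesgue_outer_bounded_fin _ _ _ (r^-1)) => p pS.
have pos : 0 <= r^-1 by rewrite invr_ge0 ltW.
apply: norm_coord_le => // i.
have h (e : R) : `|e| <= r -> e * p 0 i <= 1.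
  move=> er; have := pS (z + e *: delta_mx 0 i).
  rewrite addrAC subrr add0r => /(_ _) hp.
  rewrite -dotp_delta dotpC; apply: hp; apply: zS.
  rewrite addrAC subrr add0r; apply: norm_coord_le => [|j]; first exact: ltW.
  rewrite !mxE normrM; apply: le_trans er; rewrite ler_piMr//.
  by case: (_ && _); rewrite ?normr1 ?normr0.
rewrite -[r^-1]mul1r ler_pdivlMr// -[X in _ * X](gtr0_norm r0) -normrM
  ler_norml.
have /h : `|r| <= r by rewrite gtr0_norm.
have /h : `|-r| <= r by rewrite normrN gtr0_norm.
lra.
Qed.

Lemma polar_gt0 S z r : 0 < r -> (forall x, S x -> `|x| <= r) ->
  (0 < lebesgue_outer (polar S z))%E.
Proof.
(* The ball of radius [d^-1] about 0 lies in the polar, by the bound [dotp_norm]; the added 1 keeps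
   [d] positive. *)
move=> r0 Sr; pose d := n%:R * (r + `|z|) + 1.
have d0 : 0 < d by rewrite ltr_wpDl// mulr_ge0// addr_ge0// ltW.
apply: (@lebesgue_outer_ball_gt0 _ _ _ 0 d^-1); first by rewrite invr_gt0.
move=> p; rewrite subr0 => pd s Ss.
apply: le_trans (ler_norm _) _; apply: le_trans (dotp_norm _ _) _.
have sz : `|s - z| <= r + `|z|.
  by apply: le_trans (ler_normB _ _) _; rewrite lerD2r; exact: Sr.
have : `|p| * `|s - z| <= d^-1 * (r + `|z|) by apply: ler_pM.
move=> /(ler_wpM2l (ler0n _ n))/le_trans; apply.
by rewrite mulrCA ler_pdivrMl// mulr1 /d lerDl.
Qed.

(* Translates of a quarter of the polar at z along the long vector q are
   disjoint and stay in the polar at x. *)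
Lemma polar_lower S x z q (N : nat) :
  S x -> S (z - (x - z)) ->
  polar S x q -> N%:R < dotp q (x - z) ->
  ((N%:R / 4 ^+ n)%:E * lebesgue_outer (polar S z) <=
   lebesgue_outer (polar S x))%E.
Proof.
move=> Sx Sy Aq qN; set B := polar S z; set A := polar S x.
have [->|N0] := posnP N.
  by rewrite mul0r mul0e; exact: lebesgue_outer_ge0.
pose phi p := dotp p (x - z).
(* The point [x] and its reflection in [z] both lie in [S], which bounds [phi] from both sides. *)
have phiB p : B p -> `|phi p| <= 1.
  move=> Bp; rewrite ler_norml; have := Bp _ Sx; have := Bp _ Sy.
  by rewrite /phi addrAC subrr add0r dotpNr; lra.
pose c j : V := (j%:R / (2 * N%:R)) *: q.
pose T j := homothety (c j) 4^-1 @` B.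
(* Paired with [s - x], the multiple of [q] contributes at most 1/2, the quarter of [p] paired with
   [s - z] at most 1/4, and recentring from [z] to [x] at most 1/4. *)
have TA j : (j < N)%N -> T j `<=` A.
  move=> jN _ [p Bp <-] s Ss; rewrite /homothety !dotpE.
  have th1 : j%:R / (2 * N%:R) <= 2^-1 :> R.
    rewrite ler_pdivrMr ?mulr_gt0 ?ltr0n// mulrA mulVf// mul1r ler_nat.
    exact: ltnW.
  have th0 : 0 <= j%:R / (2 * N%:R) :> R by rewrite divr_ge0// mulr_ge0.
  have := Aq _ Ss; have := Bp _ Ss; have := phiB _ Bp.
  rewrite /phi ler_norml !dotpE; nra.
(* Put [sigma = phi q / (2 * N%:R)], which exceeds 1/2. On [T j] the values of [phi] are within 1/4
   of [j * sigma], so the half-spaces [h j] separate the translates. Their Caratheodory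
   measurability makes outer measures add without any measurability of [B]. *)
pose h j := [set p | phi p < (j%:R - 2^-1) * (phi q / (2 * N%:R))].
have mh j : caratheodory_measurable (@lebesgue_outer R n) (h j).
  apply: lebesgue_measurable_open.
  rewrite /h /phi; under eq_fun do rewrite dotpC.
  exact/open_lt_lipschitz/is_lipschitz_dotp.
have Th j : (j < N)%N -> T j `<=` h j.+1 `&` ~` h j.
  move=> jN _ [p Bp <-]; have N1 : 0 < N%:R :> R by rewrite ltr0n.
  have sig : 2^-1 < phi q / (2 * N%:R).
    by rewrite ltr_pdivlMr ?mulr_gt0// mulrA mulVf// mul1r.
  have E : phi (homothety (c j) 4^-1 p) = j%:R * (phi q / (2 * N%:R)) + 4^-1 *
    phi p.
    by rewrite /homothety /phi dotpDl !dotpZl mulrA mulrAC.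
  have := phiB _ Bp; rewrite ler_norml /h/= E -[j.+1%:R]natr1 => pB.
  by split; [lra|apply/negP; rewrite -leNgt; lra].
have slab : forall j, (j <= N)%N -> ((j%:R / 4 ^+ n)%:E * lebesgue_outer B <=
     lebesgue_outer (A `&` h j))%E.
  elim=> [_|j IH jN]; first by rewrite mul0r mul0e; exact: lebesgue_outer_ge0.
  have B0 := @lebesgue_outer_ge0 R n B.
  rewrite -natr1 mulrDl mul1r EFinD ge0_muleDl ?lee_fin ?invr_ge0 ?exprn_ge0
    ?divr_ge0 ?exprn_ge0//.
  rewrite (mh j (A `&` h j.+1)); apply: leeD.
    apply: le_trans (IH (ltnW jN)) _; apply: le_lebesgue_outer => p [Ap hp].
    split=> //; split=> //; move: hp; rewrite /h/=; move/lt_le_trans; apply.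
    rewrite ler_pM2r ?lerB// ?ler_nat//.
    by rewrite divr_gt0 ?mulr_gt0 ?ltr0n// (le_lt_trans _ qN).
  rewrite -exprVn -(lebesgue_outer_homothety (c j) _ B) ?invr_gt0//.
  by apply: le_lebesgue_outer => p Tp; have [hj hj'] := Th _ jN _ Tp;
    split=> //; split=> //; exact: TA Tp.
apply: le_trans (slab N (leqnn N)) _.
by apply: le_lebesgue_outer => p [].
Qed.

End Polar.

Section Subgradient.
Context {R : realType} {n : nat}.
Local Notation V := 'rV[R]_n.
Implicit Types (x y z p q : V) (S : set V) (w : V -> R).

Definition cvx w := forall x y t, 0 <= t <= 1 ->
  w ((1 - t) *: x + t *: y) <= (1 - t) * w x + t * w y.

Lemma subdifferential_add_affine w q (b : R) x p :
  subdifferential (fun y => w y - (dotp q y + b)) x p <->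
  subdifferential w x (p + q).
Proof.
by split => h y; have := h y; rewrite !dotpE; lra.
Qed.

(* Compare w with the cone of vertex (x, w x) over S. *)
Lemma polar_subgradient_image w x : cvx w -> is_lipschitz w ->
  bounded_set [set y | w y <= 0] -> w x < 0 ->
  [set (- w x) *: p | p in polar [set y | w y <= 0] x] `<=`
  subgradient_image w [set y | w y <= 0].
Proof.
move=> cw lw bS wx _ [p pS <-]; set S := [set y | w y <= 0] in pS bS *.
have cS : compact S.
  apply: bounded_closed_compact => //.
  exact: closed_le_lipschitz.
pose g y := w y - dotp ((- w x) *: p) y.
have lg : is_lipschitz g by apply: is_lipschitzB => //;
  exact: is_lipschitz_dotp.
have Sx : S x by exact: ltW.
have [c Sc gc] := lipschitz_min S g lg cS (ex_intro _ _ Sx).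
(* A minimum where [w < 0] extends to a global one by convexity. If the minimizer [c] has [w c = 0],
   the polar condition at [c] gives [g x <= g c], so [x] is a minimizer too. *)
have [y [wy gy]] : exists y, w y < 0 /\ forall t, S t -> g y <= g t.
  have [wc|wc] := ltP (w c) 0.
    by exists c; split => // t /gc.
  exists x; split => // t /gc; apply: le_trans.
  by rewrite /g !dotpZl; have := pS _ Sc; rewrite dotpBr; nra.
exists y; first exact: ltW.
(* The step from [y] towards [z] is short enough for convexity to keep [w] nonpositive; the added 1
   keeps the denominator positive. *)
move=> z; pose t := Num.min 1 (- w y / (Num.max (w z - w y) 0 + 1)).
have d0 : 0 < Num.max (w z - w y) 0 + 1.
  by rewrite ltr_wpDl// le_max lexx orbT.
have t0 : 0 < t by rewrite lt_min ltr01 divr_gt0// oppr_gt0.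
have t1 : t <= 1 by rewrite ge_min lexx.
have wt := cw y z t; rewrite t1 ltW// in wt; have {}wt := wt isT.
have tm : t * Num.max (w z - w y) 0 <= - w y.
  have : t <= - w y / (Num.max (w z - w y) 0 + 1) by rewrite ge_min lexx orbT.
  rewrite ler_pdivlMr// mulrDr mulr1; lra.
have Szt : S ((1 - t) *: y + t *: z).
  rewrite /S/=; apply: le_trans wt _.
  have : t * (w z - w y) <= t * Num.max (w z - w y) 0.
    by rewrite ler_pM2l// le_max lexx.
  lra.
have := gy _ Szt; rewrite /g !dotpE.
by move=> h; rewrite -(ler_pM2l t0); lra.
Qed.

(** Let [y] be the midpoint of [z] and [x], and [p] a subgradient at [y]. Since [y - z = x - y], the
    pairing of [p] with [s - z] is the sum of those with [s - y] and [x - y], and each is at most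
    [- w y <= m]. *)
Lemma subgradient_image_sub_polar w z m S :
  S z -> (forall x, S x -> w x <= 0) ->
  (forall x, S x ->
    S ((1/2) *: (z + x)) /\ - m <= w ((1/2) *: (z + x))) ->
  0 < m ->
  subgradient_image w [set (1/2) *: (z + x) | x in S] `<=`
  [set (2 * m) *: p | p in polar S z].
Proof.
move=> Sz S0 Sm m0 p [_ [x Sx <-] px]; have [_ mx] := Sm _ Sx.
exists ((2 * m)^-1 *: p); last by rewrite scalerA divff ?scale1r// mulf_neq0
  ?gt_eqF.
move=> s Ss; rewrite dotpZl mulrC ler_pdivrMr ?mulr_gt0// mul1r.
have := px s; have := px x; have := S0 _ Ss; have := S0 _ Sx.
rewrite !dotpE; lra.
Qed.

End Subgradient.

(** * Integrals, and differentiability almost everywhere *)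

Section LebesgueIntegral.
Context {R : realType} {n : nat}.
Local Notation V := 'rV[R]_n.
Local Notation Vm := (caratheodory_type (@lebesgue_outer R n)).
Local Notation lam := (lebesgue_rV R n).
Implicit Types (c x z : V) (t : R) (A D E : set Vm).

Lemma homothetyVK c t : t != 0 ->
  cancel (homothety (- (t^-1 *: c)) t^-1) (homothety c t).
Proof.
move=> t0 y; rewrite /homothety scalerDr scalerN !scalerA divff// !scale1r.
by rewrite addNKr.
Qed.

Lemma homothety_preimage c t A : t != 0 ->
  homothety c t @^-1` A = homothety (- (t^-1 *: c)) t^-1 @` A.
Proof.
move=> t0; apply/seteqP; split => [x Ax|_ [y Ay <-]].
  by exists (homothety c t x) => //; exact: homothetyK.
by rewrite /preimage/= homothetyVK.
Qed.

Lemma caratheodory_homothety_preimage c t A : 0 < t ->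
  caratheodory_measurable (@lebesgue_outer R n) A ->
  caratheodory_measurable (@lebesgue_outer R n) (homothety c t @^-1` A).
Proof.
move=> t0 mA X; have tV : 0 < t^-1 by rewrite invr_gt0.
have E Y : lebesgue_outer Y =
    ((t^-1 ^+ n)%:E * lebesgue_outer (homothety c t @` Y))%E.
  rewrite lebesgue_outer_homothety// muleA -EFinM -exprMn mulVf ?gt_eqF//.
  by rewrite expr1n mul1e.
rewrite (E X) (E (X `&` _)) (E (X `&` ~` _)) -muleDr//.
  congr (_ * _)%E; rewrite (mA (homothety c t @` X)); congr (_ + _)%E.
    congr lebesgue_outer; apply/seteqP; split =>
      [_ [[x Xx <-] Ax]|_ [x [Xx Ax] <-]].
      by exists x.
    by split => //; exists x.
  congr lebesgue_outer; apply/seteqP; split =>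
    [_ [[x Xx <-] Ax]|_ [x [Xx Ax] <-]].
    by exists x.
  by split => //; exists x.
by apply: ge0_adde_def; rewrite inE; exact: lebesgue_outer_ge0.
Qed.

Lemma measurable_homothety_preimage c t A : 0 < t -> measurable A ->
  measurable (homothety c t @^-1` A : set Vm).
Proof. exact: caratheodory_homothety_preimage. Qed.

Lemma measurable_fun_homothety c t : 0 < t ->
  measurable_fun [set: Vm] (homothety c t : Vm -> Vm).
Proof. by move=> t0 _ A mA; rewrite setTI;
  exact: measurable_homothety_preimage. Qed.

Lemma lipschitz_measurable (f : V -> R) : is_lipschitz f ->
  measurable_fun [set: Vm] (f : Vm -> R).
Proof.
move=> lf; apply: (measurability _ (RGenCInfty.measurableE R)) =>
  _ [_ [a ->] <-].
rewrite setTI; apply: lebesgue_measurable_borel; apply: borel_closed.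
rewrite (_ : _ @^-1` _ = [set x | - f x <= - a]).
  by apply: closed_le_lipschitz; exact: is_lipschitzN.
by apply/seteqP; split => x /=; rewrite in_itv/= andbT lerN2.
Qed.

(* Unlike ge0_le_integral, this applies to the right-hand side of the equation,
   which is not known to be measurable. *)
Lemma le_integral_nonneg D (f g : Vm -> \bar R) :
  (forall x, D x -> 0 <= f x)%E -> (forall x, D x -> f x <= g x)%E ->
  (\int[lam]_(x in D) f x <= \int[lam]_(x in D) g x)%E.
Proof.
move=> f0 fg; rewrite !ge0_integralE//; last first.
  by move=> x Dx; apply: le_trans (fg x Dx); exact: f0.
apply: le_ereal_sup => _ [h hf <-]; exists h => // x.
apply: le_trans (hf x) _; rewrite /patch; case: ifPn => // xD.
by apply: fg; exact: set_mem.
Qed.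

(** Here [f] may be negative: it stands for the density, and the sign of [star u] is unknown where
    partial derivatives fail. The negative part only lowers the integral. *)
Lemma le_integral_pos D (f g : Vm -> \bar R) :
  (forall x, D x -> 0 <= g x)%E -> (forall x, D x -> f x <= g x)%E ->
  (\int[lam]_(x in D) f x <= \int[lam]_(x in D) g x)%E.
Proof.
move=> g0 fg; rewrite integralE -[leRHS]sube0; apply: leeB.
  apply: le_integral_nonneg => x Dx; rewrite funeposE ?le_max ?lexx ?orbT//.
  by rewrite ge_max fg ?g0.
by apply: integral_ge0 => x _; rewrite funenegE le_max lexx orbT.
Qed.

(** Change of variables: the pushforward of Lebesgue measure by the homothety is [t^-1 ^+ n] times
    Lebesgue measure. *)
Lemma ge0_integral_homothety c t D (f : Vm -> \bar R) : 0 < t ->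
  measurable D -> measurable_fun D f -> (forall x, D x -> 0 <= f x)%E ->
  (\int[lam]_(x in homothety c t @^-1` D) f (homothety c t x) =
   (t^-1 ^+ n)%:E * \int[lam]_(x in D) f x)%E.
Proof.
move=> t0 mD mf f0; have tV : 0 <= t^-1 ^+ n by rewrite exprn_ge0// invr_ge0
  ltW.
have mh := measurable_fun_homothety c t t0.
rewrite -[LHS](ge0_integral_pushforward mh)//; last by move=> x /set_mem /f0.
rewrite -(ge0_integral_mscale _ mD (NngNum tV))//.
apply: eq_measure_integral => A mA _; rewrite /=.
change (lebesgue_outer (homothety c t @^-1` A) =
  ((t^-1 ^+ n)%:E * lebesgue_outer A)%E).
rewrite homothety_preimage ?gt_eqF//.
by rewrite [LHS]lebesgue_outer_homothety ?invr_gt0.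
Qed.

End LebesgueIntegral.

(** * Partial derivatives of a convex function almost everywhere *)

Section JumpNull.
Context {R : realType} {n : nat}.
Local Notation V := 'rV[R]_n.
Local Notation Vm := (caratheodory_type (@lebesgue_outer R n)).
Local Notation lam := (lebesgue_rV R n).
Implicit Types (x z : V) (t d : R).
Variables (u : V -> R) (L : R).
Hypothesis L0 : 0 <= L.
Hypothesis uL : forall x y, `|u x - u y| <= L * `|x - y|.
Hypothesis ucvx : cvx u.

Local Notation e i := (delta_mx 0 i : V).

(** For convex [u] the second difference divided by [h] decreases, as [h] decreases to 0, to the gap
    between the right and left derivatives along axis [i]. So these are the points with gap at least
    [d]; quantifying over all [h] makes the set closed. *)
Definition derivative_jump (i : 'I_n) d : set V :=
  [set x | forall h, 0 < h ->
    d * h <= u (x + h *: e i) + u (x - h *: e i) - 2 * u x].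

Lemma norm_delta i t : `|t *: e i| <= `|t|.
Proof.
apply: norm_coord_le => // j; rewrite !mxE normrM ler_piMr//.
by case: (_ && _); rewrite ?normr1 ?normr0.
Qed.

Lemma delta_coord i k t : 0 <= t <= 1 -> 0 <= (t *: e i) 0 k <= 1.
Proof.
by move=> t01; rewrite !mxE eqxx/=; case: (k == i);
  rewrite ?mulr1 ?mulr0 ?lexx ?ler01.
Qed.

Lemma cvx_midpoint x y : 2 * u x <= u (x + y) + u (x - y).
Proof.
have := ucvx (x + y) (x - y) 2^-1; rewrite invr_ge0 ler0n/= invf_le1// ler1n
  => /(_ isT).
rewrite (_ : _ *: _ + _ *: _ = x); first lra.
apply/rowP => j; rewrite !mxE; lra.
Qed.

Lemma closed_derivative_jump i d : closed (derivative_jump i d).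
Proof.
have -> : derivative_jump i d = \bigcap_(h in [set h : R | 0 < h])
   [set x | 2 * u x - u (x + h *: e i) - u (x - h *: e i) <= - (d * h)].
  by apply/seteqP; split => x /= xj h h0; have := xj h h0; rewrite /=; lra.
apply: closed_bigI => h _; apply: closed_le_lipschitz.
have lu : is_lipschitz u by exists L.
have l2u : is_lipschitz (fun x => 2 * u x).
  by under eq_fun do rewrite mulr2n mulrDl mul1r; exact: is_lipschitzD.
by apply: is_lipschitzB; [apply: is_lipschitzB => //|];
  exact: is_lipschitz_shift.
Qed.

Lemma caratheodory_jump i d : measurable (derivative_jump i d : set Vm).
Proof.
by apply: lebesgue_measurable_borel; apply: borel_closed;
  exact: closed_derivative_jump.
Qed.

(* The M translates of the jump set by multiples of e_i / M cover each point at
   most 2 L / d times, because along a line the slope of u varies by at most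
   2 L in total. *)
Lemma jump_translates i d (M : nat) x : 0 < d ->
  \sum_(j < M) \1_(derivative_jump i d) (x - (j%:R / M%:R) *: e i) <= 2 * L / d.
Proof.
move=> d0; have [->|M0] := posnP M.
  by rewrite big_ord0 divr_ge0 ?mulr_ge0// ltW.
have M1 : 0 < M%:R :> R by rewrite ltr0n.
(* Samples of [u] with spacing [1 / M], shifted by one so that [a j.+1] is taken at the [j]-th
   point. A jump there makes the second difference about it at least [d / M], and second differences
   telescope. *)
pose a j := u (x + ((1 - j%:R) / M%:R) *: e i).
have E (m : nat) : \sum_(j < m) (a j + a j.+2 - 2 * a j.+1) =
    (a m.+1 - a m) - (a 1%N - a 0%N).
  elim: m => [|m IH]; first by rewrite big_ord0; lra.
  by rewrite big_ord_recr/= IH; lra.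
have step j : \1_(derivative_jump i d) (x - (j%:R / M%:R) *: e i) * (d / M%:R)
    <= a j + a j.+2 - 2 * a j.+1.
  have aj k (s : R) : s = (1 - k%:R) / M%:R ->
    a k = u (x + s *: e i) by move=> ->.
  have -> : a j = u (x - (j%:R / M%:R) *: e i + M%:R^-1 *: e i).
    by rewrite -addrA -scaleNr -scalerDl; apply: aj; rewrite mulrBl; lra.
  have -> : a j.+2 = u (x - (j%:R / M%:R) *: e i - M%:R^-1 *: e i).
    rewrite -addrA -opprD -scalerDl -scaleNr; apply: aj.
    by rewrite -[j.+2%:R]natr1 -[j.+1%:R]natr1; lra.
  have -> : a j.+1 = u (x - (j%:R / M%:R) *: e i).
    by rewrite -scaleNr; apply: aj; rewrite -[j.+1%:R]natr1 mulrBl mulrDl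
      mul1r; lra.
  rewrite indicE; case: (boolP (_ \in _)) => [/set_mem|_].
    by rewrite mul1r => /(_ M%:R^-1); apply; rewrite invr_gt0.
  by rewrite mul0r subr_ge0; exact: cvx_midpoint.
have aL j : `|a j.+1 - a j| <= L / M%:R.
  apply: le_trans (uL _ _) _; rewrite ler_wpM2l//.
  rewrite opprD addrACA subrr add0r -scalerBl;
    apply: le_trans (norm_delta _ _) _.
  rewrite -mulrBl -natr1 (_ : _ * _ = - M%:R^-1); last lra.
  by rewrite normrN ger0_norm// invr_ge0.
rewrite ler_pdivlMr// -(ler_pM2r (x := M%:R^-1)) ?invr_gt0// -mulrA mulr_suml.
apply: (@le_trans _ _ (\sum_(j < M) (a j + a j.+2 - 2 * a j.+1))).
  by apply: ler_sum => j _; exact: step.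
by rewrite E; have := aL M; have := aL 0%N; rewrite !ler_norml; lra.
Qed.

(** The [M] translates of [E] have the measure of [E], lie in one box [B] and overlap at most
    [2 * L / d] times. So [M] times the measure of [E] stays bounded as [M] grows. *)
Lemma jump_bounded_null i d r : 0 < d ->
  lebesgue_outer
    (derivative_jump i d `&` box (const_mx (- r), const_mx r)) = 0%E.
Proof.
move=> d0; set E := _ `&` _.
pose B : set Vm := box (const_mx (- r - 1), const_mx (r + 1)).
have mB : measurable B by exact: lebesgue_measurable_box.
have mE : measurable (E : set Vm).
  apply: measurableI; first exact: caratheodory_jump.
  exact: lebesgue_measurable_box.
have Bfin : (lam B < +oo)%E.
  by apply: le_lt_trans (lebesgue_outer_box _) _; rewrite ltry.
pose T M j : set Vm := homothety (- ((j%:R / M%:R) *: e i)) 1 @^-1` E.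
have mT M j : measurable (T M j) by apply: measurable_homothety_preimage.
have lamT M j : lam (T M j) = lebesgue_outer E.
  rewrite /T homothety_preimage ?oner_neq0//= [LHS]lebesgue_outer_homothety
    ?invr1//.
  by rewrite expr1n mul1e.
have TB M j : (j < M)%N -> T M j `<=` B.
  move=> jM x [_ xE] k; have := xE k; set a : R := j%:R / M%:R.
  have M0 : 0 < M%:R :> R by rewrite ltr0n (leq_ltn_trans _ jM).
  have a01 : 0 <= a <= 1 by rewrite divr_ge0//= ler_pdivrMr// mul1r ler_nat
    ltnW.
  pose b := (a *: e i) 0 k; have b01 : 0 <= b <= 1 by exact: delta_coord.
  have -> : homothety (- (a *: e i)) 1 x 0 k = x 0 k - b.
    by rewrite /homothety scale1r addrC /b !mxE.
  by rewrite !mxE; lra.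
have bound M : (M%:R%:E * lebesgue_outer E <= (2 * L / d)%:E * lam B)%E.
  have mI (j : 'I_M) : measurable_fun B (fun x => (\1_(T M j) x : R)%:E).
    by apply/measurable_EFinP; exact: measurable_indic.
  have I0 (j : 'I_M) (x : Vm) : B x -> (0 <= (\1_(T M j) x : R)%:E)%E.
    by move=> _; rewrite lee_fin.
  have <- : (\int[lam]_(x in B) (\sum_(j < M) (\1_(T M j) x : R)%:E) =
      M%:R%:E * lebesgue_outer E)%E.
    rewrite (ge0_integral_sum lam mB mI I0).
    rewrite (eq_bigr (fun=> lebesgue_outer E)); last first.
      by move=> j _; rewrite integral_indic// setIidl ?lamT//; exact: TB.
    elim: M {mI I0} => [|M IH]; first by rewrite big_ord0 mul0e.
    by rewrite big_ord_recr/= IH -natr1 EFinD ge0_muleDl ?lee_fin// mul1e.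
  rewrite -integral_cst//; apply: le_integral_nonneg => x Bx.
    by apply: sume_ge0 => j _; rewrite lee_fin.
  rewrite sumEFin lee_fin; apply: le_trans (jump_translates i d M x d0).
  apply: ler_sum => j _; rewrite !indicE; case: (boolP (x \in _)) => //.
  move=> /set_mem[]; rewrite /homothety scale1r addrC => /mem_set -> _ //.
have finB : lam B \is a fin_num by rewrite ge0_fin_numE.
have E0 := @lebesgue_outer_ge0 R n E.
apply/eqP; rewrite eq_le E0 andbT leNgt; apply/negP => Epos.
have Efin : lebesgue_outer E \is a fin_num.
  rewrite ge0_fin_numE//; apply: le_lt_trans Bfin; apply: le_lebesgue_outer.
  move=> x [_ xE] k; have := xE k; rewrite !mxE; lra.
move: bound Epos; rewrite -(fineK finB) -(fineK Efin) lte_fin.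
set ee := fine _; set b := fine _ => bound ee0.
have := bound (Num.bound (2 * L / d * b / ee)).
rewrite -!EFinM lee_fin; apply/negP; rewrite -ltNge -ltr_pdivrMr//.
apply: archi_boundP; rewrite divr_ge0 ?mulr_ge0 ?divr_ge0 ?invr_ge0//;
  try exact: ltW.
by rewrite fine_ge0.
Qed.

Lemma jump_null i d : 0 < d -> lebesgue_outer (derivative_jump i d) = 0%E.
Proof.
move=> d0; pose F (r : nat) := derivative_jump i d `&` box (const_mx (- r%:R),
  const_mx r%:R).
apply/eqP; rewrite eq_le lebesgue_outer_ge0 andbT.
apply: (@le_trans _ _ (lebesgue_outer (\bigcup_r F r))).
  apply: le_lebesgue_outer => x xj; exists (Num.bound `|x|) => //; split=> // k.
  rewrite !mxE -ler_norml; apply: le_trans (norm_coord _ _) _.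
  by apply/ltW/archi_boundP.
apply: le_trans (lebesgue_outer_sigma_subadditive _) _.
by rewrite eseries0// => r _ _; exact: jump_bounded_null.
Qed.

(* Off this null set all partial derivatives of u exist. *)
Definition singular_set : set V := \bigcup_k
  (if unpickle k is Some p then derivative_jump p.1 p.2.+1%:R^-1 else set0).

Lemma singular_set_borel : borel_rV singular_set.
Proof.
apply: sigma_algebra_bigcup => k; case: unpickle => [p|].
  by apply: borel_closed; exact: closed_derivative_jump.
exact: sigma_algebra0.
Qed.

Lemma singular_set_null : lebesgue_outer singular_set = 0%E.
Proof.
apply/eqP; rewrite eq_le lebesgue_outer_ge0 andbT.
apply: le_trans (lebesgue_outer_sigma_subadditive _) _.
rewrite eseries0// => k _ _; case: unpickle => [p|];
  last exact: lebesgue_outer0.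
exact: jump_null.
Qed.

(** Difference quotients at scales below [h] lie between [p 0 i] and the one at scale [h] on the
    same side, by monotonicity of slopes. Off the jump sets some [h] brings the quotients on the two
    sides of [x] within [eps] of each other. *)
Lemma gradient_subdifferential x p :
  ~ singular_set x -> subdifferential u x p -> gradient u x = p.
Proof.
move=> nx px; apply/rowP => i; rewrite mxE; apply: cvg_lim => //.
apply/cvgrPdist_le => eps eps0.
have [m _ /(_ m (leqnn _)) /= meps] := near_infty_natSinv_lt (PosNum eps0).
have [h h0 hx] : exists2 h, 0 < h &
    u (x + h *: e i) + u (x - h *: e i) - 2 * u x < m.+1%:R^-1 * h.
  apply: contra_notP nx => nh; exists (pickle (i, m)) => //;
    rewrite pickleK => h h0.
  by rewrite leNgt; apply/negP => hh; apply: nh; exists h.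
apply/nbhs_ballP; exists h => //= s; rewrite /ball/= sub0r normrN => sh s0.
rewrite /shift/= [s *: _ + x]addrC.
have sub t : t * p 0 i <= u (x + t *: e i) - u x.
  by have := px (x + t *: e i); rewrite addrAC subrr add0r dotpC dotp_delta;
    lra.
have slope t : 0 < t -> t < h -> forall y,
    h * (u (x + t *: y) - u x) <= t * (u (x + h *: y) - u x).
  move=> t0 th y; have := ucvx x (x + h *: y) (t / h).
  have -> : (1 - t / h) *: x + (t / h) *: (x + h *: y) = x + t *: y.
    by rewrite scalerDr addrA -scalerDl subrK scale1r scalerA mulfVK// gt_eqF.
  have th01 : 0 <= t / h <= 1.
    apply/andP; split; first by rewrite divr_ge0// ltW.
    by rewrite ler_pdivrMr// mul1r ltW.
  move=> /(_ th01) cx.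
  have -> : t * (u (x + h *: y) - u x) =
      h * ((1 - t / h) * u x + t / h * u (x + h *: y) - u x).
    by field; rewrite gt_eqF.
  by rewrite ler_pM2l// lerD2r.
have hx' : u (x + h *: e i) + u (x - h *: e i) - 2 * u x < eps * h.
  by apply: lt_trans hx _; rewrite ltr_pM2r.
have sub1 := sub h; have sub2 := sub (- h); have sub3 := sub s.
rewrite scaleNr in sub2.
have [s_lt0|s_gt0|s_eq0] := ltgtP s 0; last by rewrite s_eq0 eqxx in s0.
- have s'0 : 0 < - s by rewrite oppr_gt0.
  have sh' : - s < h by move: sh; rewrite ltr0_norm.
  have := slope (- s) s'0 sh' (- e i); rewrite !scalerN scaleNr opprK => sl.
  have -> : p 0 i - s^-1 *: (u (x + s *: e i) - u x) =
    (u (x + s *: e i) - u x - s * p 0 i) / (- s).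
    by rewrite /GRing.scale/=; field; rewrite ltr0_neq0.
  rewrite ger0_norm ?divr_ge0 ?subr_ge0//; last exact: ltW.
  rewrite ler_pdivrMr// -(ler_pM2l h0); nra.
- have sh' : s < h by move: sh; rewrite gtr0_norm.
  have sl := slope s s_gt0 sh' (e i).
  have -> : p 0 i - s^-1 *: (u (x + s *: e i) - u x) =
    - ((u (x + s *: e i) - u x - s * p 0 i) / s).
    by rewrite /GRing.scale/=; field; rewrite gt_eqF.
  rewrite normrN ger0_norm ?divr_ge0 ?subr_ge0//; last exact: ltW.
  rewrite ler_pdivrMr// -(ler_pM2l h0); nra.
Qed.

(** Valid at every point, so that the density is bounded above on [singular_set] as well. *)
Lemma gradient_bound x i : `|gradient u x 0 i| <= L.
Proof.
rewrite mxE /derive; set F := (X in lim X).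
(* A partial derivative that does not exist has the junk value 0. *)
have [cF|/dvgP ->] := pselect (cvg F); last by rewrite normr0.
apply/ler_addgt0Pr => eps eps0.
have /cvgrPdist_le /(_ _ eps0) := cF.
move=> /nbhs_ballP[h /= h0 hF].
have h2 : 0 < h / 2 by rewrite divr_gt0.
have := hF (h / 2); rewrite /ball/= sub0r normrN gtr0_norm// gtr_pMr//
  invf_lt1// ltr1n.
move=> /(_ isT); rewrite gt_eqF// => /(_ isT) hl.
have : `|(h / 2)^-1 *: (u ((h / 2) *: e i + x) - u x)| <= L.
  rewrite /GRing.scale/= normrM (gtr0_norm (x := (h / 2)^-1)) ?invr_gt0// mulrC.
  rewrite ler_pdivrMr//.
  apply: le_trans (uL _ _) _; rewrite ler_wpM2l// addrK.
  by apply: le_trans (norm_delta _ _) _; rewrite gtr0_norm.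
move: hl; rewrite /shift/=; set l := lim _; set q := _ *: _.
rewrite !ler_norml; lra.
Qed.

End JumpNull.

(** * Monge-Ampere mass *)

Section Mass.
Context {R : realType} {n : nat}.
Local Notation V := 'rV[R]_n.
Local Notation Vm := (caratheodory_type (@lebesgue_outer R n)).
Local Notation lam := (lebesgue_rV R n).
Implicit Types (x z : V) (t r : R).
Variables (u : V -> R) (L k : R).
Hypothesis L0 : 0 <= L.
Hypothesis uL : forall x y, `|u x - u y| <= L * `|x - y|.
Hypothesis ucvx : cvx u.
Hypothesis usub : forall x, exists p, subdifferential u x p.
Hypothesis u0 : u 0 < 0.
Hypothesis k0 : 0 < k.
Hypothesis ueq : alexandrov_solution u
  (fun x => star u x ^+ n.+2 * (Num.max (- u x) 0) `^ k).

Let F x : R := (Num.max (- u x) 0) `^ k.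

Let F0 x : 0 <= F x. Proof. exact: powR_ge0. Qed.

Let mF (D : set Vm) : measurable_fun D (fun x : Vm => (F x)%:E).
Proof.
have mf : measurable_fun [set: Vm] (fun x : Vm => Num.max (- u x) 0).
  apply: lipschitz_measurable; exists L => // x y.
  apply: le_trans (uL x y); rewrite -[leRHS]normrN opprB.
  rewrite /Num.max; do 2 case: ifPn; rewrite -?leNgt => h1 h2;
    rewrite ?ler_norml ?subrr ?normr0//;
    do ?[case: (ler0P (u y - u x)); lra].
have mpow : measurable_fun [set: Vm] (fun x : Vm => F x).
  exact: (measurableT_comp (measurable_powR k) mf).
by apply: (measurable_funS measurableT (@subsetT _ D)); exact/measurable_EFinP.
Qed.

Lemma star_upper x r :
  `|x| <= r -> `|star u x| <= n%:R * (r * L) + (`|u 0| + L * r).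
Proof.
move=> xr; apply: le_trans (ler_normB _ _) _; apply: lerD.
  apply: le_trans (dotp_norm _ _) _; rewrite ler_wpM2l//; apply: ler_pM => //.
  by apply: norm_coord_le => // i; exact: gradient_bound.
have -> : u x = u 0 + (u x - u 0) by rewrite addrC subrK.
apply: le_trans (ler_normD _ _) _; rewrite lerD2l; apply: le_trans (uL _ _) _.
by rewrite subr0 ler_wpM2l.
Qed.

(** Off [singular_set] the gradient is a subgradient; its inequality is tested at the origin. *)
Lemma star_lower x : ~ singular_set u x -> - u 0 <= star u x.
Proof.
move=> nx; have [p px] := usub x.
have E := gradient_subdifferential _ ucvx _ _ nx px.
by rewrite /star E dotpC; have := px 0; rewrite sub0r dotpNr; lra.
Qed.

Lemma mass_upper r : exists2 c, 0 <= c & forall E, borel_rV E ->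
  (forall x, E x -> `|x| <= r) ->
  (lam (subgradient_image u E) <= c%:E * \int[lam]_(x in E) (F x)%:E)%E.
Proof.
pose s := n%:R * (r * L) + (`|u 0| + L * r).
exists (`|s| ^+ n.+2) => [|E bE Er]; first by rewrite exprn_ge0.
have mE : measurable (E : set Vm) by exact: lebesgue_measurable_borel.
rewrite ueq// -ge0_integralZl//; [|by move=> x _; rewrite lee_fin].
apply: le_integral_pos => x Ex; rewrite -EFinM lee_fin.
  by apply: mulr_ge0 => //; exact: exprn_ge0.
apply: (ler_wpM2r (F0 x)); apply: le_trans (ler_norm _) _.
rewrite normrX lerXn2r ?nnegrE//; apply: le_trans (star_upper _ _ (Er _ Ex)) _.
exact: ler_norm.
Qed.

Lemma mass_lower E : borel_rV E -> (forall x, E x -> ~ singular_set u x) ->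
  (((- u 0) ^+ n.+2)%:E * \int[lam]_(x in E) (F x)%:E <=
   lam (subgradient_image u E))%E.
Proof.
move=> bE Es; have mE : measurable (E : set Vm) by exact:
  lebesgue_measurable_borel.
have u00 : 0 <= - u 0 by rewrite oppr_ge0 ltW.
rewrite ueq// -ge0_integralZl//; [|by move=> x _;
  rewrite lee_fin|by rewrite lee_fin exprn_ge0].
apply: le_integral_nonneg => x Ex; rewrite -EFinM lee_fin.
  by apply: mulr_ge0 => //; exact: exprn_ge0.
have su := star_lower _ (Es _ Ex).
by apply: ler_wpM2r => //; rewrite lerXn2r ?nnegrE//; apply: le_trans su.
Qed.

Lemma density_halving z x : u z <= 0 ->
  F x <= 2 `^ k * F (homothety (2^-1 *: z) 2^-1 x).
Proof.
move=> uz; rewrite -powRM//; last by rewrite le_max lexx orbT.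
apply: ge0_ler_powR; rewrite ?nnegrE ?le_max ?lexx ?orbT ?mulr_ge0 ?le_max
  ?lexx ?orbT//.
  exact: ltW.
have := ucvx z x 2^-1; rewrite invr_ge0 ler0n/= invf_le1// ler1n => /(_ isT).
rewrite (_ : 1 - 2^-1 = 2^-1 :> R); last lra.
rewrite -/(homothety _ _ _) => uh; rewrite ge_max mulr_ge0 ?le_max ?lexx
  ?orbT// andbT.
have : - u (homothety (2^-1 *: z) 2^-1 x) <=
    Num.max (- u (homothety (2^-1 *: z) 2^-1 x)) 0.
  by rewrite le_max lexx.
lra.
Qed.

(** The map is the homothety of ratio 1/2 centred at [z]. In the application [Z] is the half-size
    copy of a section and the preimage is the section itself. *)
Lemma mass_doubling r : exists2 c : R, 0 <= c & forall z Z, u z <= 0 ->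
  closed Z -> closed (homothety (2^-1 *: z) 2^-1 @^-1` Z) ->
  (forall x, Z (homothety (2^-1 *: z) 2^-1 x) -> `|x| <= r) ->
  (lam (subgradient_image u (homothety (2^-1 *: z) 2^-1 @^-1` Z)) <=
   c%:E * lam (subgradient_image u Z))%E.
Proof.
have [c c0 hc] := mass_upper r; have u00 : 0 < (- u 0) ^+ n.+2 by rewrite
  exprn_gt0 ?oppr_gt0.
(* The factors come from the upper bound on the mass, from [density_halving], from the change of
   variables and from the lower bound on [star u]. *)
exists (c * (2 `^ k * 2 ^+ n) / (- u 0) ^+ n.+2) => [|z Z uz cZ cS Sr].
  by apply: divr_ge0 (ltW u00); apply: mulr_ge0; rewrite // mulr_ge0 ?powR_ge0.
set S := _ @^-1` Z.
have mZ : measurable (Z : set Vm) by apply: lebesgue_measurable_borel;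
  exact: borel_closed.
have mS : measurable (S : set Vm) by apply: lebesgue_measurable_borel;
  exact: borel_closed.
have bs := singular_set_borel _ _ L0 uL.
have bN : borel_rV (Z `\` singular_set u).
  exact: (@measurableD _ (g_sigma_algebraType [set A : set V | open A]) _ _
    (borel_closed _ cZ) bs).
apply: le_trans (hc _ (borel_closed _ cS) Sr) _.
have half : (\int[lam]_(x in S) (F x)%:E <=
    (2 `^ k * 2 ^+ n)%:E * \int[lam]_(x in Z) (F x)%:E)%E.
  have := @ge0_integral_homothety _ _ (2^-1 *: z) 2^-1 Z (fun x =>
    (F x)%:E) _ mZ (mF _).
  rewrite invr_gt0 ltr0n invrK => /(_ isT) hE.
  rewrite EFinM -muleA -hE; last by move=> x _; rewrite lee_fin.
  have mh (D : set Vm) : measurable_fun D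
      (fun x : Vm => (F (homothety (2^-1 *: z) 2^-1 x))%:E).
    apply: (measurable_funS measurableT (@subsetT _ D)).
    have h2 : 0 < 2^-1 :> R by rewrite invr_gt0.
    exact: (measurableT_comp (mF setT) (measurable_fun_homothety (2^-1 *: z) _
      h2)).
  rewrite -(ge0_integralZl lam mS (mh S)); [|by move=> x _;
    rewrite lee_fin|by rewrite lee_fin powR_ge0].
  apply: le_integral_nonneg => x _; first by rewrite lee_fin.
  by rewrite -EFinM lee_fin density_halving.
(* The lower bound on the density holds only off [singular_set], so this null set is removed
   first. *)
have null : (\int[lam]_(x in Z) (F x)%:E =
    \int[lam]_(x in Z `\` singular_set u) (F x)%:E)%E.
  apply: ge0_negligible_integral => //; first exact: lebesgue_measurable_borel.
    by move=> x _; rewrite lee_fin.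
  exact: (singular_set_null _ _ L0 uL ucvx).
have lower := mass_lower _ bN (fun x => @proj2 _ _).
have {}lower : (((- u 0) ^+ n.+2)%:E * \int[lam]_(x in Z) (F x)%:E <=
    lam (subgradient_image u Z))%E.
  rewrite null; apply: le_trans lower _; apply: le_lebesgue_outer.
  by move=> p [x [Zx _] px]; exists x.
rewrite -mulrA EFinM -muleA; apply: lee_wpmul2l; first by rewrite lee_fin.
apply: le_trans half _.
rewrite (EFinM (2 `^ k * 2 ^+ n)) -muleA; apply: lee_wpmul2l.
  by rewrite lee_fin mulr_ge0 ?powR_ge0 ?exprn_ge0.
by rewrite lee_pdivlMl.
Qed.

Lemma mass_positive_part E : borel_rV E -> (forall x, E x -> 0 <= u x) ->
  lam (subgradient_image u E) = 0%E.
Proof.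
move=> bE Eu; rewrite ueq//; apply: integral0_eq => x /Eu ux.
by rewrite (_ : Num.max _ _ = 0) ?powR0 ?mulr0 ?gt_eqF//; apply/max_idPr;
  rewrite oppr_le0.
Qed.

End Mass.

Lemma bounded_norm_le {R : realType} {n : nat} (S : set 'rV[R]_n) (r : R) :
  (forall x, S x -> `|x| <= r) -> bounded_set S.
Proof.
move=> Sr; exists r; split; first exact: num_real.
by move=> M rM x Sx; apply: le_trans (Sr _ Sx) (ltW rM).
Qed.

(** * Legendre transform *)

Section Legendre.
Context {R : realType} {n : nat}.
Local Notation V := 'rV[R]_n.
Variables (P : set V) (v : V -> R).
Hypothesis P_bounded : bounded_set P.
Hypothesis P_open : open P.
Hypothesis P0 : P 0.
Hypothesis v_gt0 : forall y, closure P y -> 0 < v y.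
Hypothesis v_inf : 0 < inf (v @` closure P).

Local Notation u := (legendre P v).

Let vP y : P y -> 0 < v y. Proof. by move=> Py; exact/v_gt0/subset_closure. Qed.

Let bnd : exists2 r, 0 <= r & forall y, P y -> `|y| <= r.
Proof.
have [M [_ hM]] := P_bounded; exists (`|M| + 1) => [|y Py];
  first by rewrite addr_ge0.
by apply: hM => //; rewrite (le_lt_trans (ler_norm M))// ltrDl.
Qed.

Lemma legendre_ge x y : P y -> dotp x y - v y <= u x.
Proof.
have [r r0 Pr] := bnd.
move=> Py; apply: ub_le_sup; last by exists y.
exists (n%:R * (`|x| * r)) => _ [z Pz <-].
apply: (@le_trans _ _ (dotp x z)); first by rewrite gerBl ltW// vP.
apply: le_trans (ler_norm _) _; apply: le_trans (dotp_norm _ _) _.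
by rewrite ler_wpM2l// ler_wpM2l// Pr.
Qed.

Lemma legendre_le x t : (forall y, P y -> dotp x y - v y <= t) -> u x <= t.
Proof.
move=> h; apply: ge_sup; first by exists (dotp x 0 - v 0); exists 0.
by move=> _ [y Py <-]; exact: h.
Qed.

Lemma legendre_lipschitz :
  exists2 L, 0 <= L & forall x y, `|u x - u y| <= L * `|x - y|.
Proof.
have [r r0 Pr] := bnd; exists (n%:R * r) => [|x y]; first by rewrite mulr_ge0.
suff h x' y' : u x' <= u y' + n%:R * r * `|x' - y'|.
  by rewrite ler_norml; have := h x y; have := h y x; rewrite (distrC y); lra.
apply: legendre_le => z Pz; have := legendre_ge y' z Pz.
have : dotp (x' - y') z <= n%:R * r * `|x' - y'|.
  apply: le_trans (ler_norm _) _; apply: le_trans (dotp_norm _ _) _.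
  by rewrite -mulrA ler_wpM2l// mulrC ler_wpM2r// Pr.
by rewrite dotpBl; lra.
Qed.

Lemma legendre_cvx : cvx u.
Proof.
move=> x y t /andP[t0 t1]; apply: legendre_le => z Pz.
have := legendre_ge x z Pz; have := legendre_ge y z Pz.
rewrite !dotpE; nra.
Qed.

Lemma legendre0_lt0 : u 0 < 0.
Proof.
apply: (@le_lt_trans _ _ (- inf (v @` closure P))); last by rewrite oppr_lt0.
apply: legendre_le => y Py; rewrite dotp0l sub0r lerN2.
apply: ge_inf; last by exists y => //; exact: subset_closure.
by exists 0 => _ [z Pz <-]; exact/ltW/v_gt0.
Qed.

(** The points of [P] at distance [e / 2] from [q] along each axis, on both sides, give affine lower
    bounds for [u]; together they control every coordinate of [x]. *)
Lemma legendre_coercive q : P q ->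
  exists2 r, 0 < r & exists c, forall x, r * `|x| <= u x - dotp q x + c.
Proof.
move=> Pq; have [e e0 qP] := open_ball _ _ P_open Pq.
exists (e / 2); first by rewrite divr_gt0.
pose s (i : 'I_n) (t : R) : V := q + t *: delta_mx 0 i.
have Ps i t : `|t| < e -> P (s i t).
  by move=> te; apply: qP; rewrite /s addrAC subrr add0r;
    apply: le_lt_trans (norm_delta _ _) te.
pose m i := `|v (s i (e / 2))| + `|v (s i (- (e / 2)))|.
have m0 i : 0 <= m i by rewrite addr_ge0.
(* The sum dominates [v] at all the test points; [v q] comes from the lower bound at [q] itself. *)
exists (v q + \sum_i m i) => x.
have ms i : m i <= \sum_i m i by rewrite (bigD1 i)//= lerDl sumr_ge0.
have e2 : 0 < e / 2 by rewrite divr_gt0.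
have ee : `|e / 2| < e by rewrite gtr0_norm// gtr_pMr// invf_lt1// ltr1n.
rewrite mulrC -ler_pdivlMr//; apply: norm_coord_le => [|i].
  rewrite divr_ge0 ?(ltW e2)//; have := legendre_ge x q Pq.
  have Sm : 0 <= \sum_i m i by exact: sumr_ge0.
  by rewrite dotpC; lra.
rewrite ler_pdivlMr// -[X in _ * X](gtr0_norm e2) -normrM ler_norml.
have dE t : dotp x (s i t) = dotp q x + t * x 0 i.
  by rewrite dotpDr (dotpC x q) (dotpC x) dotp_delta.
have h1 := legendre_ge x _ (Ps i _ ee).
have := Ps i (- (e / 2)); rewrite normrN => /(_ ee) /(legendre_ge x) h2.
have := ms i; have := ler_norm (v (s i (e / 2)));
  have := ler_norm (v (s i (- (e / 2)))).
have := normr_ge0 (v (s i (e / 2))); have := normr_ge0 (v (s i (- (e / 2)))).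
by move: h1 h2; rewrite !dE /m; have := vP _ Pq; lra.
Qed.

(** The supremum over the open set [P] need not be attained. A maximizing sequence has a cluster
    point in the compact closure, and the inequalities of [legendre_ge] pass to the limit along
    it. *)
Lemma legendre_subdifferential x : exists p, subdifferential u x p.
Proof.
have [r r0 Pr] := bnd.
have cP : compact (closure P).
  apply: bounded_closed_compact; last exact: closed_closure.
  apply: (bounded_norm_le _ r) => y Py.
  have cB : closed [set y : V | `|y| <= r].
    apply: closed_le_lipschitz; exists 1 => // z z'.
    by rewrite mul1r ler_dist_dist.
  by have := closure_subset Pr Py; rewrite -(closure_id _).1.
have hs : has_sup [set dotp x y - v y | y in P].
  split; first by exists (dotp x 0 - v 0); exists 0.
  by exists (u x) => _ [y Py <-]; exact: legendre_ge.
pose G e := [set y | P y /\ u x - e < dotp x y - v y].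
have G0 e : 0 < e -> G e !=set0.
  by move=> e0; have [_ [y Py <-] yx] := sup_adherent e0 hs; exists y.
pose y_ (m : nat) : V := xget 0 (G m.+1%:R^-1).
have Gy m : G m.+1%:R^-1 (y_ m).
  by apply: xgetPex; apply: G0; rewrite invr_gt0.
have [p [_ pcl]] := cP (y_ @ \oo) _ (filterE _ (fun m =>
  subset_closure (Gy m).1)).
exists p => y; apply/ler_addgt0Pr => e e0.
pose d := n%:R * `|y - x| + 1.
have d0 : 0 < d by rewrite ltr_wpDl// mulr_ge0.
have e2 : 0 < e / 2 by rewrite divr_gt0.
have Fm : (y_ @ \oo) [set y_ m | m in [set m | m.+1%:R^-1 < e / 2]].
  have := near_infty_natSinv_lt (PosNum e2).
  by apply: filterS => m me; exists m.
have Np : nbhs p [set q | `|q - p| < e / 2 / d].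
  apply/nbhs_ballP; exists (e / 2 / d); first by rewrite /= divr_gt0.
  by move=> q; rewrite mx_norm_ball /ball_/= distrC.
have [_ [[m me <-] /= qp]] := pcl _ _ Fm Np.
have [Pm um] := Gy m; have := legendre_ge y _ Pm.
have : dotp (p - y_ m) (y - x) <= e / 2.
  apply: le_trans (ler_norm _) _; apply: le_trans (dotp_norm _ _) _.
  rewrite distrC mulrCA; rewrite ltr_pdivlMr// in qp.
  apply: le_trans (ltW qp); rewrite ler_wpM2l// /d lerDl//.
have {me}um : u x - e / 2 < dotp x (y_ m) - v (y_ m).
  by apply: lt_trans um; rewrite ltrD2l ltrN2.
by move: um; rewrite !dotpE (dotpC x) (dotpC y); lra.
Qed.

End Legendre.

(** * The contact set *)

Section ContactSet.
Context {R : realType} {n : nat}.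
Local Notation V := 'rV[R]_n.
Local Notation lam := (@lebesgue_outer R n).
Implicit Types (x y z p q : V) (t e : R) (S : set V).

Lemma compact_norm_le S r :
  closed S -> (forall x, S x -> `|x| <= r) -> compact S.
Proof. by move=> cS Sr; apply: bounded_closed_compact => //;
  exact: bounded_norm_le Sr. Qed.

Lemma lebesgue_outer_scale t S : 0 < t ->
  lam [set t *: x | x in S] = ((t ^+ n)%:E * lam S)%E.
Proof.
move=> t0; rewrite -(lebesgue_outer_homothety 0)//; congr lebesgue_outer.
by apply: eq_imagel => x _; rewrite /homothety add0r.
Qed.

Lemma subgradient_image_affine (w : V -> R) q b S :
  lam (subgradient_image (fun y => w y - (dotp q y + b)) S) =
  lam (subgradient_image w S).
Proof.
rewrite -[LHS](lebesgue_outer_translate q); congr lebesgue_outer.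
apply/seteqP; split => [_ [p [x Sx px] <-]|p [x Sx px]].
  by exists x => //; rewrite addrC; exact/subdifferential_add_affine.
exists (p - q); last by rewrite addrC subrK.
by exists x => //; apply/subdifferential_add_affine; rewrite subrK.
Qed.

Lemma cvx_affine (w : V -> R) q b :
  cvx w -> cvx (fun y => w y - (dotp q y + b)).
Proof. by move=> cw x y t t01; have := cw x y t t01; rewrite !dotpE; lra. Qed.

Lemma is_lipschitz_affine (w : V -> R) q b : is_lipschitz w ->
  is_lipschitz (fun y => w y - (dotp q y + b)).
Proof.
move=> lw; apply: is_lipschitzB => //; apply: is_lipschitzD;
  last exact: is_lipschitz_cst.
exact: is_lipschitz_dotp.
Qed.

Lemma lipschitz_neg_ball (w : V -> R) z : is_lipschitz w -> w z < 0 ->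
  exists2 r, 0 < r & forall x, `|x - z| <= r -> w x <= 0.
Proof.
move=> [L L0 wL] wz; exists (- w z / (L + 1)).
  by rewrite divr_gt0 ?oppr_gt0// ltr_wpDl.
move=> x; rewrite ler_pdivlMr ?ltr_wpDl// => xz.
have := wL x z; rewrite ler_norml => /andP[_].
have : L * `|x - z| <= `|x - z| * (L + 1) by rewrite mulrC ler_wpM2l// lerDl.
lra.
Qed.

Lemma cvx_half (w : V -> R) x y : cvx w ->
  w (2^-1 *: (x + y)) <= 2^-1 * (w x + w y).
Proof.
move=> /(_ x y 2^-1); rewrite invr_ge0 ler0n/= invf_le1// ler1n => /(_ isT).
by rewrite (_ : 1 - 2^-1 = 2^-1 :> R) ?scalerDr ?mulrDr//; lra.
Qed.

Variables (u W : V -> R) (p0 d : V) (b : R) (r0 r1 c0 c1 : R).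
Hypothesis lu : is_lipschitz u.
Hypothesis cu : cvx u.
Hypothesis WE : W = fun x => u x - (dotp p0 x + b).
Hypothesis W0 : forall x, 0 <= W x.
Hypothesis r0_gt0 : 0 < r0.
Hypothesis r1_gt0 : 0 < r1.
Hypothesis coW : forall x, r1 * `|x| <= W x - dotp d x + c1.
Hypothesis cou : forall x, r0 * `|x| <= u x + c0.

(** This is [u - (l + e (d - t))] for the supporting affine function [l]; its sublevel set at 0 is
    the section of [u]. *)
Definition tilt e t x := W x - (dotp (e *: d) x - e * t).

Let tiltE e t : tilt e t = fun x => u x - (dotp (p0 + e *: d) x + (b - e * t)).
Proof. by apply/funext => x; rewrite /tilt WE !dotpE; lra. Qed.

Lemma cvx_tilt e t : cvx (tilt e t).
Proof. by rewrite tiltE; exact: cvx_affine. Qed.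

Lemma is_lipschitz_tilt e t : is_lipschitz (tilt e t).
Proof. by rewrite tiltE; exact: is_lipschitz_affine. Qed.

Lemma subgradient_image_tilt e t S :
  lam (subgradient_image (tilt e t) S) = lam (subgradient_image u S).
Proof. by rewrite tiltE subgradient_image_affine. Qed.

Lemma lW : is_lipschitz W. Proof. by rewrite WE;
  exact: is_lipschitz_affine. Qed.
Lemma cW : cvx W. Proof. by rewrite WE; exact: cvx_affine. Qed.

(** Since [W >= 0] and [e <= 1], on the section [W x <= dotp d x - t]. Coercivity of [W - d] then
    bounds all sections at level [t], uniformly in [e]. *)
Lemma tilt_le0 e t x : 0 < e <= 1 -> tilt e t x <= 0 ->
  t <= dotp d x /\ `|x| <= (c1 - t) / r1.
Proof.
move=> /andP[e0 e1]; rewrite /tilt dotpZl => wx.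
have tx : t <= dotp d x by have := W0 x; nra.
split=> //; rewrite ler_pdivlMr// mulrC; apply: le_trans (coW x) _; nra.
Qed.

(* As e tends to 0 the sections {tilt e t <= 0} shrink to a part of {W = 0}. *)
Lemma tilt_avoids t (Q : set V) : compact Q -> (forall x, Q x -> 0 < W x) ->
  exists2 e, 0 < e <= 1 & forall x, Q x -> 0 < tilt e t x.
Proof.
move=> cQ QW; have [Q0|] := pselect (Q !=set0); last first.
  by move=> nQ; exists 1 => [|x Qx]; [rewrite ltr01 lexx|case: nQ; exists x].
have [x Qx xmin] := lipschitz_min Q W lW cQ Q0.
have [y Qy ymin] := lipschitz_min Q _ (is_lipschitzN _ (is_lipschitz_dotp d))
  cQ Q0.
(* [M] bounds [d - t] on [Q], where [d] is largest at [y]; [e] makes [e * M] at most half the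
   minimum of [W]. *)
have mx := QW _ Qx; pose M := `|dotp d y - t| + 1.
have M0 : 0 < M by rewrite ltr_wpDl.
pose e := Num.min 1 (W x / 2 / M).
have e0 : 0 < e by rewrite lt_min ltr01/= !divr_gt0.
have eM : e * M <= W x / 2 by rewrite -ler_pdivlMr// ge_min lexx orbT.
exists e => [|z Qz]; first by rewrite e0 ge_min lexx.
have := xmin _ Qz; have := ymin _ Qz; rewrite /tilt dotpZl => zy Wz.
have : dotp d z - t <= M.
  by rewrite /M; have := ler_norm (dotp d y - t); lra.
move=> /(ler_wpM2l (ltW e0)); lra.
Qed.

Lemma closed_tilt e t : closed [set x | tilt e t x <= 0].
Proof. exact/closed_le_lipschitz/is_lipschitz_tilt. Qed.

Definition tilt_section e t : set V := [set y | tilt e t y <= 0].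

(** Comparison with the cone of vertex [x]; passing from [tilt e t] to [u] only translates the
    gradient image. *)
Lemma tilt_polar_le e t x : 0 < e <= 1 -> tilt e t x < 0 ->
  (((- tilt e t x) ^+ n)%:E * lam (polar (tilt_section e t) x) <=
   lam (subgradient_image u (tilt_section e t)))%E.
Proof.
move=> e01 wx; rewrite -lebesgue_outer_scale ?oppr_gt0//.
rewrite -(subgradient_image_tilt e t); apply: le_lebesgue_outer.
apply: polar_subgradient_image => //; [exact: cvx_tilt|exact:
  is_lipschitz_tilt|].
by apply: bounded_norm_le => y; move/(tilt_le0 e t y e01) => [_]; exact.
Qed.

Let C : set V := [set x | W x <= 0].

(* A maximum of the linear function d over the contact set C outside
   {u <= 0} would be cut off by a section carrying no Monge-Ampere mass. *)
Lemma contact_max_neg (xh : V) :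
  (forall E, closed E -> (forall x, E x -> 0 <= u x) ->
    lam (subgradient_image u E) = 0%E) ->
  C xh -> u xh <= 0 ->
  (forall x, C x -> u x <= 0 -> dotp d x <= dotp d xh) ->
  forall x, C x -> dotp d x <= dotp d xh.
Proof.
move=> mass0 Cxh uxh xmax x1 Cx1; rewrite leNgt; apply/negP => x1gt.
(* Strictly between the two values: the section at [x1] is genuine, while [C] misses the part [Q] of
   [{u <= 0}] with [d >= t], so for small [e] the section misses [{u <= 0}]. *)
pose t := (dotp d xh + dotp d x1) / 2.
pose Q : set V := [set x | u x <= 0] `&` [set x | - dotp d x <= - t].
have cQ : compact Q.
  apply: (@compact_norm_le _ (c0 / r0)).
    apply: closedI; first exact: closed_le_lipschitz.
    exact/closed_le_lipschitz/is_lipschitzN/is_lipschitz_dotp.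
  move=> x [/= ux _]; rewrite ler_pdivlMr// mulrC.
  by apply: le_trans (cou x) _; lra.
have QW x : Q x -> 0 < W x.
  move=> [/= ux dx]; rewrite ltNge; apply/negP => Wx.
  by have := xmax _ Wx ux; rewrite /t in dx; lra.
have [e e01 eQ] := tilt_avoids t Q cQ QW.
have /andP[e0 _] := e01.
set S := tilt_section e t.
have Su x : S x -> 0 <= u x.
  move=> Sx; have [tx _] := tilt_le0 e t x e01 Sx.
  have [//|ux] := leP 0 (u x); have := eQ x (conj (ltW ux) _).
  by rewrite /= lerN2 => /(_ tx); rewrite ltNge Sx.
have wx1 : tilt e t x1 < 0.
  have Wx1 : W x1 = 0 by apply/eqP; rewrite eq_le W0 Cx1.
  by rewrite /tilt Wx1 dotpZl /t; nra.
have := tilt_polar_le e t x1 e01 wx1.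
rewrite -/S mass0//; last exact: closed_tilt.
apply/negP; rewrite -ltNge mule_gt0// ?lte_fin ?exprn_gt0 ?oppr_gt0//.
have [_ x1r] := tilt_le0 e t x1 e01 (ltW wx1).
apply: (@polar_gt0 _ _ _ _ ((c1 - t) / r1 + 1)) => [|x Sx].
  by rewrite ltr_wpDl// (le_trans _ x1r).
by have [_ xr] := tilt_le0 e t x e01 Sx; rewrite ler_wpDr.
Qed.

Lemma contact_constant (xh a : V) :
  (forall r, exists2 K : R, 0 <= K & forall z Z, u z <= 0 -> closed Z ->
    closed (homothety (2^-1 *: z) 2^-1 @^-1` Z) ->
    (forall x, Z (homothety (2^-1 *: z) 2^-1 x) -> `|x| <= r) ->
    (lam (subgradient_image u (homothety (2^-1 *: z) 2^-1 @^-1` Z)) <=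
     K%:E * lam (subgradient_image u Z))%E) ->
  C xh -> u xh <= 0 -> (forall x, C x -> dotp d x <= dotp d xh) ->
  C a -> u a <= 0 -> dotp d xh <= dotp d a.
Proof.
move=> doubling Cxh uxh xmax Ca ua; rewrite leNgt; apply/negP => axh.
pose M := dotp d xh; pose t := dotp d a; pose eta := M - t.
have eta0 : 0 < eta by rewrite subr_gt0.
have WC x : C x -> W x = 0 by move=> Cx; apply/eqP; rewrite eq_le W0 Cx.
pose rho := (c1 - t) / r1.
have [K K0 hK] := doubling rho.
(* The estimates below combine to [N / 4 ^ n <= K * 4 ^ n], which this choice contradicts. *)
pose N := Num.bound (K * 16 ^+ n).
have KN : K * 16 ^+ n < N%:R by apply: archi_boundP;
  rewrite mulr_ge0 ?exprn_ge0.
(* [tau] is the overshoot of [d] past [M] allowed on the section. Then [tau^-1 *: d] lies in the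
   polar at [xh], and its pairing with [xh - z] is [eta / (2 * tau) = N + 1], above [N]. *)
pose tau := eta / (2 * N.+1%:R).
have tau0 : 0 < tau by rewrite divr_gt0// mulr_gt0.
have tau_eta : tau <= eta.
  rewrite ler_pdivrMr ?mulr_gt0// ler_peMr ?(ltW eta0)//.
  by rewrite -natrM ler1n.
pose Q : set V := [set x | `|x| <= rho] `&` [set x | - dotp d x <= - (M + tau)].
have cQ : compact Q.
  apply: (@compact_norm_le _ rho) => [|x []//].
  apply: closedI.
    apply: closed_le_lipschitz; exists 1 => // z z'.
    by rewrite mul1r ler_dist_dist.
  exact/closed_le_lipschitz/is_lipschitzN/is_lipschitz_dotp.
have QW x : Q x -> 0 < W x.
  move=> [_ /= dx]; rewrite ltNge; apply/negP => Wx.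
  by have := xmax _ Wx; rewrite -/M; lra.
have [e e01 eQ] := tilt_avoids t Q cQ QW.
have /andP[e0 e1] := e01.
pose w := tilt e t; pose S := tilt_section e t.
have SE x : S x = (w x <= 0) :> Prop by [].
have Sb x : S x -> [/\ t <= dotp d x, `|x| <= rho & dotp d x <= M + tau].
  move=> Sx; have [tx xr] := tilt_le0 e t x e01 Sx; split=> //.
  rewrite leNgt; apply/negP => dx.
  by have := eQ x (conj xr _); rewrite /= lerN2 (ltW dx) => /(_ isT);
    rewrite ltNge Sx.
have wxh : w xh = - (e * eta) by rewrite /w /tilt WC// dotpZl /eta /M; lra.
have wa : w a = 0 by rewrite /w /tilt WC// dotpZl /t; lra.
pose z := 2^-1 *: (a + xh).
have Wz : W z = 0.
  apply/eqP; rewrite eq_le W0 andbT; apply: le_trans (cvx_half _ _ _ cW) _.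
  by rewrite !WC// addr0 mulr0.
have uz : u z <= 0 by apply: le_trans (cvx_half _ _ _ cu) _; lra.
have wz : w z < 0.
  by apply: le_lt_trans (cvx_half _ _ _ (cvx_tilt e t)) _; rewrite -/w wa wxh;
    nra.
have [rz rz0 ballz] := lipschitz_neg_ball w z (is_lipschitz_tilt e t) wz.
pose B := polar S z; pose A := polar S xh.
have Bfin : (lam B < +oo)%E by exact: polar_fin rz0 ballz.
have Bpos : (0 < lam B)%E.
  apply: (@polar_gt0 _ _ _ _ (rho + 1)) => [|x /Sb[_ xr _]];
    last by rewrite ler_wpDr.
  have [_ zr _] := Sb z (ltW wz).
  by rewrite ltr_wpDl// (le_trans _ zr).
have xhz : xh - z = 2^-1 *: (xh - a).
  by apply/rowP => i; rewrite !mxE; lra.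
have zxa : z - (xh - z) = a by apply/rowP => i; rewrite !mxE; lra.
have AB : ((N%:R / 4 ^+ n)%:E * lam B <= lam A)%E.
  apply: (polar_lower S xh z (tau^-1 *: d)).
  - by rewrite SE wxh oppr_le0 mulr_ge0// ltW.
  - by rewrite zxa SE wa.
  - move=> s /Sb[_ _ ds]; rewrite dotpZl ler_pdivrMl// dotpBr mulr1 -/M; lra.
  - rewrite dotpZl xhz dotpZr dotpBr -/M -/t -/eta ltr_pdivlMl//.
    rewrite /tau mulrAC ltr_pdivrMr ?mulr_gt0//.
    have : N%:R < N.+1%:R :> R by rewrite ltr_nat.
    nra.
have lower : (((e * eta) ^+ n)%:E * lam A <= lam (subgradient_image u S))%E.
  have := tilt_polar_le e t xh e01; rewrite -/w wxh opprK; apply.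
  by rewrite oppr_lt0 mulr_gt0.
pose h := homothety (2^-1 *: z) 2^-1.
pose Z : set V := [set (1/2) *: (z + x) | x in S].
have hE x : h x = (1/2) *: (z + x) by rewrite /h /homothety scalerDr mul1r.
have hZ : h @^-1` Z = S.
  apply/seteqP; split => [x [y Sy]|x Sx]; last by exists x; rewrite ?hE.
  by rewrite -hE => /(can_inj (homothetyK _ _ _)) <-.
have ZS x : S x -> S ((1/2) *: (z + x)).
  rewrite !SE mul1r => Sx; apply: le_trans (cvx_half _ _ _ (cvx_tilt e t)) _.
  by rewrite -/w; have := ltW wz; lra.
(* On the section [d - t <= eta + tau <= 2 * eta], so [w >= - (2 * (e * eta))];
   [subgradient_image_sub_polar] doubles this bound, whence the 4. *)
have upper : (lam (subgradient_image u Z) <=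
    ((4 * (e * eta)) ^+ n)%:E * lam B)%E.
  rewrite -(subgradient_image_tilt e t) -/w.
  have m0 : 0 < 2 * (e * eta) by rewrite !mulr_gt0.
  rewrite (_ : 4 * _ = 2 * (2 * (e * eta))); last lra.
  rewrite -lebesgue_outer_scale ?mulr_gt0//; apply: le_lebesgue_outer.
  apply: subgradient_image_sub_polar => //; first exact: ltW.
  move=> x Sx; split; first exact: ZS.
  have [_ _ dx] := Sb _ (ZS _ Sx); rewrite /w /tilt dotpZl.
  have := W0 ((1/2) *: (z + x)); move: dx; rewrite /eta in eta0 tau_eta *; nra.
have cZ : closed Z.
  rewrite (_ : Z = [set y | w (homothety (- z) 2 y) <= 0]).
    apply: closed_le_lipschitz.
    have [L L0 wL] := is_lipschitz_tilt e t.
    exists (L * 2) => [|x y]; first by rewrite mulr_ge0.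
    apply: le_trans (wL _ _) _; rewrite /homothety opprD addrACA subrr add0r.
    by rewrite -scalerBr normrZ ger0_norm// mulrA.
  apply/seteqP; split => [_ [x Sx <-]|y wy].
    rewrite /= (_ : homothety _ _ _ = x)//.
    by apply/rowP => i; rewrite /homothety !mxE; lra.
  exists (homothety (- z) 2 y) => //.
  by apply/rowP => i; rewrite /homothety !mxE; lra.
have := hK z Z uz cZ; rewrite -/h hZ => /(_ (closed_tilt e t)).
have Zr x : Z (h x) -> `|x| <= rho.
  by move=> Zx; have /Sb[] : S x by rewrite -hZ.
move=> /(_ Zr) dbl.
have ee0 : 0 < e * eta by exact: mulr_gt0.
have fB : lam B \is a fin_num by rewrite ge0_fin_numE// ltW.
have b0 : 0 < fine (lam B) by rewrite fine_gt0// Bpos.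
have : ((((e * eta) ^+ n) * (N%:R / 4 ^+ n) * fine (lam B))%:E <=
   (K * ((4 * (e * eta)) ^+ n * fine (lam B)))%:E)%E.
  rewrite !EFinM fineK// -muleA.
  apply: le_trans (lee_wpmul2l _ AB) _; first by rewrite lee_fin exprn_ge0//
    ltW.
  apply: le_trans lower _; apply: le_trans dbl _.
  by apply: lee_wpmul2l.
rewrite lee_fin; apply/negP; rewrite -ltNge (mulrA K) ltr_pM2r//.
have -> : K * (4 * (e * eta)) ^+ n = (e * eta) ^+ n * (K * 4 ^+ n).
  by rewrite exprMn; ring.
rewrite ltr_pM2l ?exprn_gt0// ltr_pdivlMr ?exprn_gt0//.
by rewrite -mulrA -exprMn (_ : 4 * 4 = 16 :> R) -?natrM.
Qed.

End ContactSet.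

(** * Absence of segments in the free boundary *)

Lemma segment_mem {R : realType} {n : nat} (a b : 'rV[R]_n) t : 0 <= t <= 1 ->
  segment a b ((1 - t) *: a + t *: b).
Proof. by move=> t01; exists t; rewrite //= in_itv. Qed.

Theorem proposition5p3 (R : realType) (n : nat) (P : set 'rV[R]_n) (k : R)
    (u v : 'rV[R]_n -> R)
    (P_bounded : bounded_set P) (P_open : open P) (P_convex : convex_set P)
    (P0 : P 0) (k_gt0 : 0 < k)
    (v_convex : convex_function (closure P) v)
    (v_gt0 : forall y, closure P y -> 0 < v y)
    (v_inf : 0 < inf (v @` closure P))
    (u_legendre : u = legendre P v)
    (u_convex : convex_function setT u)
    (u_eq : alexandrov_solution u
       (fun x => star u x ^+ n.+2 * (Num.max (- u x) 0) `^ k))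
    (u_image : subgradient_image u setT = closure P) :
  contains_no_segment [set x | u x = 0].
Proof.
move=> a b ab seg.
have [L L0 uL] : exists2 L, 0 <= L & forall x y, `|u x - u y| <= L * `|x - y|.
  by rewrite u_legendre; exact: legendre_lipschitz.
have cu : cvx u by rewrite u_legendre; exact: legendre_cvx.
have usub x : exists p, subdifferential u x p.
  by rewrite u_legendre; exact: legendre_subdifferential.
have u00 : u 0 < 0 by rewrite u_legendre; exact: legendre0_lt0.
have lu : is_lipschitz u by exists L.
have coer q : P q -> exists2 r, 0 < r &
    exists c, forall x, r * `|x| <= u x - dotp q x + c.
  by rewrite u_legendre; exact: legendre_coercive.
pose c := (1 - 2^-1) *: a + 2^-1 *: b.
have ua : u a = 0.
  by apply: seg; have := segment_mem a b 0;
    rewrite subr0 scale1r scale0r addr0 lexx ler01; apply.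
have ub : u b = 0.
  by apply: seg; have := segment_mem a b 1;
    rewrite subrr scale1r scale0r add0r lexx ler01; apply.
have uc : u c = 0.
  by apply: seg; apply: segment_mem; rewrite invr_ge0 ler0n invf_le1// ler1n.
have [p0 p0c] := usub c.
pose W x := u x - (dotp p0 x + - dotp p0 c).
have W0 x : 0 <= W x by have := p0c x; rewrite /W uc dotpBr; lra.
(* The supporting affine function is at most 0 at both ends and equals 0 at the midpoint, so it
   vanishes at both ends. *)
have pab : dotp p0 a = dotp p0 c /\ dotp p0 b = dotp p0 c.
  have := p0c a; have := p0c b; rewrite ua ub uc !dotpBr.
  have : dotp p0 c = 2^-1 * dotp p0 a + 2^-1 * dotp p0 b.
    by rewrite /c !dotpE; lra.
  lra.
have Wa : W a <= 0 by rewrite /W ua; lra.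
have Wb : W b <= 0 by rewrite /W ub; lra.
(* Either [q = 0] works already, or [p0] is orthogonal to [b - a] and a small multiple of [b - a]
   works. *)
have [q Pq qab] : exists2 q, P q & dotp (q - p0) (b - a) != 0.
  have [e e0 eP] := open_ball _ _ P_open P0.
  have [E|E] := eqVneq (dotp p0 (b - a)) 0; last first.
    by exists 0; rewrite ?sub0r ?dotpNl ?oppr_eq0.
  pose s := e / 2 / (`|b - a| + 1).
  have s0 : 0 < s by rewrite !divr_gt0// ltr_wpDl.
  exists (s *: (b - a)).
    apply: eP; rewrite subr0 normrZ gtr0_norm// /s mulrAC ltr_pdivrMr
      ?ltr_wpDl//.
    by have := normr_ge0 (b - a); nra.
  have ba : b - a != 0 by rewrite subr_eq0 eq_sym.
  have sba : 0 < s * dotp (b - a) (b - a) by rewrite mulr_gt0// dotp_self_gt0.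
  by rewrite dotpBl dotpZl E subr0 gt_eqF.
have [r1 r1_gt0 [c1 coW1]] := coer q Pq.
have [r0 r0_gt0 [c0 cou0]] := coer 0 P0.
pose d := q - p0.
have coW x : r1 * `|x| <= W x - dotp d x + (c1 - dotp p0 c).
  by have := coW1 x; rewrite /W /d dotpBl; lra.
have cou x : r0 * `|x| <= u x + c0.
  by have := cou0 x; rewrite dotp0l subr0.
have lWW : is_lipschitz W by exact: is_lipschitz_affine.
pose Q := [set x | W x <= 0] `&` [set x | u x <= 0].
have cQ : compact Q.
  apply: (compact_norm_le _ (c0 / r0)).
    by apply: closedI; exact: closed_le_lipschitz.
  move=> x [_ /= ux]; rewrite ler_pdivlMr// mulrC.
  by apply: le_trans (cou x) _; lra.
have Qa : Q a by split=> //=; rewrite ua.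
have Qb : Q b by split=> //=; rewrite ub.
have [xh [Wxh uxh] xmin] := lipschitz_min Q _
  (is_lipschitzN _ (is_lipschitz_dotp d)) cQ (ex_intro _ _ Qa).
have WE : W = (fun x => u x - (dotp p0 x + - dotp p0 c)) by [].
have xmax : forall x, W x <= 0 -> dotp d x <= dotp d xh.
  apply: (contact_max_neg u W p0 d _ r0 r1 c0 _ lu cu WE W0 r0_gt0 r1_gt0 coW
    cou) => //.
    by move=> E /borel_closed; exact: (mass_positive_part u k k_gt0 u_eq).
  by move=> x Wx ux; have := xmin x (conj Wx ux); rewrite lerN2.
have dbl := mass_doubling u L k L0 uL cu usub u00 k_gt0 u_eq.
(* So [d] agrees at [a] and [b], both in [Q], against the choice of [q]. *)
have cst x : Q x -> dotp d x = dotp d xh.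
  move=> [Wx ux]; apply/eqP; rewrite eq_le xmax//=.
  exact: (contact_constant u W p0 d _ r1 _ lu cu WE W0 r1_gt0 coW xh x dbl).
by move: qab; rewrite dotpBr -/d !cst// subrr eqxx.
Qed.
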